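(* Let $X\in\{B,C\}$, $n\ge 1$, let $\lambda=(\lambda_1\ge\cdots\ge\lambda_n\ge 0)$ be a partition, $\rho=(n-1,n-2,\dots,0)$, and $w\in W$. Let $Z(\overline{\mathfrak S}^X_{\lambda,w};\mathbf z)$ be the partition function of the colored lattice model $\overline{\mathfrak S}^X_{\lambda,w}$, and let $A_w(\mathbf z,\lambda)$ be the type $X_n$ Demazure atom. Then $$Z(\overline{\mathfrak S}^X_{\lambda,w};\mathbf z)=\mathbf z^{\rho}A_w(\mathbf z,\lambda).$$
   Context: **Weyl group.** $W$ is the group of signed permutations: permutations $w$ of $\{1,\dots,n,\bar n,\dots,\bar 1\}$ with $w(\bar\imath)=\overline{w(i)}$ ($\bar{\bar\imath}=i$), with composition of functions as product. For $i<n$, $s_i$ swaps $i\leftrightarrow i+1$ (and $\bar\imath\leftrightarrow\overline{i+1}$); $s_n$ swaps $n\leftrightarrow\bar n$. $\ell$ is Coxeter length. $W$ acts on $\mathbf z=(z_1,\dots,z_n)$ by: $s_i\mathbf z$ ($i<n$) interchanges $z_i,z_{i+1}$; $s_n\mathbf z$ replaces $z_n$ by $z_n^{-1}$. For $\mu\in\mathbb Z^n$, $\mathbf z^\mu=\prod z_i^{\mu_i}$. **Demazure atoms.** On Laurent polynomials put $\overline\pi_i f(\mathbf z)=\frac{f(\mathbf z)-f(s_i\mathbf z)}{z_iz_{i+1}^{-1}-1}$ for $i<n$; $\overline\pi_n f(\mathbf z)=\frac{f(\mathbf z)-f(s_n\mathbf z)}{z_n-1}$ in type $B$; $\overline\pi_n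 f(\mathbf z)=\frac{f(\mathbf z)-f(s_n\mathbf z)}{z_n^2-1}$ in type $C$. They satisfy the braid relations. For a reduced word $w=s_{i_1}\cdots s_{i_k}$, $A_w(\mathbf z,\lambda)=\overline\pi_{i_1}\cdots\overline\pi_{i_k}\mathbf z^\lambda$. **Colors.** There are $2n$ colors, ordered $c_1>c_2>\cdots>c_n>\overline{c}_n>\cdots>\overline{c}_1$; bar is an involution on colors, and $c_{\bar k}:=\overline{c}_k$. A spin is a color or $0$. **Grid.** There are $2n$ horizontal rows numbered $1,\dots,2n$ from top to bottom and $m\ge\lambda_1+n$ columns numbered $0,1,\dots,m-1$ from right to left. Row $2i-1$ is a $\Gamma$ row with parameter $z_i$; row $2i$ is a $\Delta$ row with parameter $z_i^{-1}$. The right ends of rows $2i-1$ and $2i$ are joined by a U-turn with parameter $z_i$, with top spin (right end of row $2i-1$) and bottom spin (right end of row $2i$). **Vertex weights.** Write the spins at a vertex as (left, top, right, bottom); $c>c'$ are any colors, $d$ any color, $z$ the parameter of the row. Unlisted weights are $0$. $\Gamma$: $(0,0,0,0)\mapsto1$; $(c',c,c,c')\mapsto z$; $(c,c',c,c')\mapsto z$; $(d,d,d,d)\mapsto z$; $(d,0,d,0)\mapsto z$; $(0,d,d,0)\mapsto1$; $(d,0,0,d)\mapsto z$. $\Delta$: $(0,0,0,0)\mapsto z$; $(c',c',c,c)\mapsto1$; $(c',c,c',c)\mapsto1$; $(d,d,d,d)\mapsto1$; $(d,0,d,0)\mapsto1$; $(d,d,0,0)\mapsto1$; $(0,0,d,d)\mapsto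 z$. U-turns (top, bottom), for $u\in\{c_1,\dots,c_n\}$: $(0,0)\mapsto z^{-2}$ in type $C$ and $z^{-2}+z^{-1}$ in type $B$; $(u,\overline u)\mapsto1$; $(\overline u,\overline u)\mapsto1$. **Boundary of $\overline{\mathfrak S}^X_{\lambda,w}$.** Bottom edges are $0$; the left edge of each $\Gamma$ row is $0$; the left edge of row $2i$ is $\overline{c_{w^{-1}(i)}}$, $i=1,\dots,n$; the top edge of column $\lambda_i+n-i$ is $c_i$, and the other top edges are $0$. **Partition function.** A state assigns spins to all interior edges (including the horizontal edges ending at the U-turns); its weight is the product of all vertex and U-turn weights; $Z(\overline{\mathfrak S}^X_{\lambda,w};\mathbf z)$ is the sum of the weights of all states. *)

(* Defs.v *)
From HB Require Import structures.
From mathcomp Require Import all_boot all_fingroup all_algebra.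
From mathcomp Require Import mpoly.

Set Implicit Arguments.
Unset Strict Implicit.
Unset Printing Implicit Defensive.

Import GRing.Theory.
Local Open Scope ring_scope.

(* Indices 1, ..., n are represented by 'I_n, hence shifted down by one. *)

Variant cartan_type := TypeB | TypeC.

(* (i, false) is the letter i, (i, true) is the letter i-bar. *)
Definition signed (n : nat) : finType := ('I_n * bool)%type.

Definition bar (n : nat) (x : signed n) : signed n := (x.1, ~~ x.2).

Definition weyl (n : nat) : {set {perm signed n}} :=
  [set w : {perm signed n} | [forall x, w (bar x) == bar (w x)]].

(* [ordS i] is i + 1 when i + 1 < n; otherwise i is the last index, and the
   reflection is the sign change s_n. *)
Definition simple_reflection (n : nat) (i : 'I_n) : {perm signed n} :=
  if (i.+1 < n)%N then
    (tperm ((i, false) : signed n) (ordS i, false) *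
     tperm ((i, true) : signed n) (ordS i, true))%g
  else tperm ((i, false) : signed n) (i, true).

(* The product s_{i_1} ... s_{i_k} for composition of functions; the group law
   of {perm T} is the opposite one, (u * v) x = v (u x). *)
Definition word_perm (n : nat) (s : seq 'I_n) : {perm signed n} :=
  foldr (fun i u => (u * simple_reflection i)%g) 1%g s.

Definition reduced_word (n : nat) (s : seq 'I_n) (w : {perm signed n}) : Prop :=
  word_perm s = w /\
  forall s' : seq 'I_n, word_perm s' = w -> (size s <= size s')%N.

Section Functions.
Variables (R : idomainType) (n : nat).

(* Laurent polynomials are handled inside the field of rational functions. *)
Definition ratfun : fieldType := {fraction {mpoly R[n]}}.

Definition zvar (i : 'I_n) : ratfun := tofrac ('X_i : {mpoly R[n]}).

Definition zmonomial (mu : 'I_n -> int) : ratfun := \prod_(i < n) zvar i ^ mu i.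

(* The result f(v) does not depend on the numerator and denominator chosen to
   represent f when v is algebraically independent over R; this is the case of
   all the families v used below. *)
Definition substitute (v : 'I_n -> ratfun) (f : ratfun) : ratfun :=
  let ev := mmap (fun c : R => tofrac (c%:MP : {mpoly R[n]}) : ratfun) v in
  ev (\n_(generic_quotient.repr f)) / ev (\d_(generic_quotient.repr f)).

Definition reflected_vars (i : 'I_n) : 'I_n -> ratfun :=
  if (i.+1 < n)%N then fun j => zvar (tperm i (ordS i) j)
  else fun j => if j == i then (zvar j)^-1 else zvar j.

Definition demazure_denominator (X : cartan_type) (i : 'I_n) : ratfun :=
  if (i.+1 < n)%N then zvar i * (zvar (ordS i))^-1 - 1
  else match X with
       | TypeB => zvar i - 1
       | TypeC => zvar i ^+ 2 - 1
       end.

Definition demazure_op (X : cartan_type) (i : 'I_n) (f : ratfun) : ratfun :=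
  (f - substitute (reflected_vars i) f) / demazure_denominator X i.

Definition demazure_atom (X : cartan_type) (s : seq 'I_n) (lambda : 'I_n -> nat)
    : ratfun :=
  foldr (demazure_op X) (zmonomial (fun i => (lambda i)%:Z)) s.

Definition rho (i : 'I_n) : int := (n - i.+1)%N%:Z.

(* The colour c_k is the signed letter k, so that c_{k-bar} is the bar of c_k. *)
Definition color : finType := signed n.

(* c_1 > ... > c_n > bar c_n > ... > bar c_1 *)
Definition color_rank (c : color) : nat :=
  if c.2 then nat_of_ord c.1 else (n.*2 - c.1.+1)%N.

Definition color_gt (c c' : color) : bool := (color_rank c' < color_rank c)%N.

(* [None] is the spin 0. *)
Definition spin : finType := option color.

Definition gamma_weight (z : ratfun) (l t r b : spin) : ratfun :=
  match l, t, r, b with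
  | None, None, None, None => 1
  | Some cl, Some ct, Some cr, Some cb =>
      if [|| [&& cl == cb, ct == cr & color_gt ct cl],
             [&& cl == cr, ct == cb & color_gt cl ct]
           | [&& cl == ct, ct == cr & cr == cb]] then z else 0
  | Some cl, None, Some cr, None => if cl == cr then z else 0
  | None, Some ct, Some cr, None => if ct == cr then 1 else 0
  | Some cl, None, None, Some cb => if cl == cb then z else 0
  | _, _, _, _ => 0
  end.

Definition delta_weight (z : ratfun) (l t r b : spin) : ratfun :=
  match l, t, r, b with
  | None, None, None, None => z
  | Some cl, Some ct, Some cr, Some cb =>
      if [|| [&& cl == ct, cr == cb & color_gt cr cl],
             [&& cl == cr, ct == cb & color_gt ct cl]
           | [&& cl == ct, ct == cr & cr == cb]] then 1 else 0
  | Some cl, None, Some cr, None => if cl == cr then 1 else 0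
  | Some cl, Some ct, None, None => if cl == ct then 1 else 0
  | None, None, Some cr, Some cb => if cr == cb then z else 0
  | _, _, _, _ => 0
  end.

(* A colour is one of c_1, ..., c_n exactly when its second component is
   [false]. *)
Definition uturn_weight (X : cartan_type) (z : ratfun) (t b : spin) : ratfun :=
  match t, b with
  | None, None => match X with
                  | TypeC => z ^- 2
                  | TypeB => z ^- 2 + z^-1
                  end
  | Some ct, Some cb =>
      if [exists u : color, ~~ u.2 && (cb == bar u)
                            && ((ct == u) || (ct == bar u))] then 1 else 0
  | _, _ => 0
  end.

(* Row 2i-1 (Gamma) is (i, false) and row 2i (Delta) is (i, true). Columns are
   numbered from right to left. The horizontal edge (i, b, j) is the right edge
   of the vertex of row (i, b) in column j, and the left edge of the vertex in
   column j - 1. The vertical edge (k, j) lies in column j, below exactly k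
   rows. *)
Definition hedge (m : nat) : finType := ('I_n * bool * 'I_m.+1)%type.
Definition vedge (m : nat) : finType := ('I_n.*2.+1 * 'I_m)%type.

Definition configuration (m : nat) : finType :=
  ({ffun hedge m -> spin} * {ffun vedge m -> spin})%type.

Definition vertex_weight (m : nat) (S : configuration m)
    (i : 'I_n) (b : bool) (j : 'I_m) : ratfun :=
  let left := S.1 (i, b, inord j.+1) in
  let right := S.1 (i, b, inord j) in
  let top := S.2 (inord (i.*2 + b), j) in
  let bottom := S.2 (inord (i.*2 + b).+1, j) in
  if b then delta_weight (zvar i)^-1 left top right bottom
  else gamma_weight (zvar i) left top right bottom.

Definition state_weight (X : cartan_type) (m : nat) (S : configuration m)
    : ratfun :=
  \prod_(i < n)
    ((\prod_(b : bool) \prod_(j < m) vertex_weight S i b j) *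
     uturn_weight X (zvar i) (S.1 (i, false, ord0)) (S.1 (i, true, ord0))).

Definition top_boundary (m : nat) (lambda : 'I_n -> nat) (j : 'I_m) : spin :=
  if [pick i : 'I_n | nat_of_ord j == (lambda i + (n - i.+1))%N] is Some i
  then Some (i, false) else None.

Definition left_boundary (w : {perm signed n}) (i : 'I_n) (b : bool) : spin :=
  if b then Some (bar ((w^-1)%g (i, false))) else None.

(* The states of the model: the spins of the boundary edges are fixed, those of
   the interior edges are free. *)
Definition is_state (m : nat) (lambda : 'I_n -> nat) (w : {perm signed n})
    (S : configuration m) : bool :=
  [&& [forall j : 'I_m, S.2 (ord0, j) == top_boundary lambda j],
      [forall j : 'I_m, S.2 (ord_max, j) == None] &
      [forall i : 'I_n, forall b : bool,
         S.1 (i, b, ord_max) == left_boundary w i b]].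

Definition partition_function (X : cartan_type) (m : nat)
    (lambda : 'I_n -> nat) (w : {perm signed n}) : ratfun :=
  \sum_(S : configuration m | is_state lambda w S) state_weight X S.

End Functions.

(* Main.v *)
Require Import Defs.
From HB Require Import structures.
From mathcomp Require Import all_boot all_fingroup all_algebra.
From mathcomp Require Import mpoly.
From mathcomp Require Import zify ring.

(** The partition function is an entry of a product of n matrices indexed by
    the spins of one horizontal level of vertical edges.  The i-th matrix is the
    transfer matrix P(z_i, a_i) of a Gamma row and a Delta row joined by a
    U-turn; it depends on the permutation w only through the colour a_i that
    leaves the pair on the left (partition_functionE).

    The proof is by induction on a reduced word.  For w = 1 only one state
    survives: the colour c_i exits row pair i as its own bar, so it runs to the
    U-turn, crossing all smaller colours horizontally, and the weight is
    z^(rho + lambda) (model_identity).  Multiplying w by s_i on the left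
    exchanges the exit colours of the pairs i and i+1, or bars the exit colour of
    the last pair.  So the theorem reduces to two local functional equations.

    Two neighbouring pairs (pair_exchange).  If a < b then
      z1 P(z2,a) P(z1,b) = z2 P(z1,a) P(z2,b) + (z2 - z1) P(z1,b) P(z2,a).
    This comes from the Yang-Baxter equation.  The difficulty is that no useful
    crossing moves a Delta row over the Gamma row below it.  There is however a
    crossing for a Gamma row over a Delta row, and on the left edges (0, a) it
    acts trivially; hence it expresses the product Delta Gamma as a combination
    of products Gamma Delta whose coefficients live on the right ends of the rows
    (mixed_exchange).  This sorts the four rows into Gamma Gamma Delta Delta.
    The crossings of two Gamma rows and of two Delta rows then exchange the
    parameters; the second one also acts on the left edges (a, b), which
    produces the last term of the equation.  What remains is a finite identity
    between the weights of the two U-turns (caduceus_sym).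

    Last pair (drain_reflect).  Below it all edges are empty, so a single colour
    enters it; the sum over the column where the colour turns back is geometric
    and gives the divided difference of the reflection z_n -> 1/z_n.

    The two equations are not symmetric in the exit colours that they relate, so
    one has to know which of these is larger: this is where reducedness enters,
    by the deletion argument (reduced_ascent).  Finally, the action of a reflection
    on rational functions is a field morphism, because the reflected variables
    are algebraically independent (substitute_morphism). *)

Set Implicit Arguments.
Unset Strict Implicit.
Unset Printing Implicit Defensive.

Import GRing.Theory.
Local Open Scope ring_scope.

(** * Crossings of coloured strands *)

Lemma color_rank_inj (n : nat) : injective (@color_rank n).
Proof.
move=> [i bi] [j bj]; rewrite /color_rank /=; have := ltn_ord i; have := ltn_ord j.
case: bi; case: bj => //= Hj Hi E; first by congr pair; apply: val_inj.
- exfalso; lia.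
- exfalso; lia.
- by congr pair; apply: val_inj => /=; lia.
Qed.

(** Boolean equations rather than an inequality and its negation: they can be
    used to rewrite the tests that compute the outcome of a vertex. *)
Lemma color_compare (n : nat) (a b : color n) :
  [\/ color_gt a b = true /\ color_gt b a = false, a = b
    | color_gt a b = false /\ color_gt b a = true].
Proof.
rewrite /color_gt; case: ltngtP => H; [by apply: Or31|by apply: Or33|].
by apply: Or32; apply: color_rank_inj.
Qed.

Lemma color_gtxx (n : nat) (a : color n) : color_gt a a = false.
Proof. exact: ltnn. Qed.

Ltac split_order a b := try (case: (color_compare a b) => [[? ?]|?|[? ?]]; subst).

Ltac use_order :=
  repeat (progress (rewrite /= ?color_gtxx;
    repeat match goal with H : color_gt ?a ?b = _ |- context [color_gt ?a ?b] =>
      rewrite H end)).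

Ltac bad_order :=
  exfalso; repeat match goal with H : color_gt _ _ = _ |- _ =>
    move: H; rewrite /color_gt; try move=> ? end; lia.

(** All orders of three colours: a vertex and a crossing never involve more
    than three of them. Some combinations of the pairwise comparisons violate
    transitivity; [bad_order] refutes these. *)
Ltac flow_cases a b c :=
  split_order a b; split_order a c; split_order b c; use_order.

Lemma color_gtE (n : nat) (i j : 'I_n) (bi bj : bool) :
  color_gt ((i, bi) : color n) (j, bj) =
  if bi then bj && (j < i)%N else bj || (i < j)%N.
Proof.
rewrite /color_gt /color_rank /=; have := ltn_ord i; have := ltn_ord j.
by case: bi; case: bj => //= ? ?; lia.
Qed.

Section Flows.
Variables (F : fieldType) (n : nat).
Local Notation S := (spin n).
Implicit Types (z q : F).

(** A vertex is read along the flow of colours. Colours move to the right and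
    down in a Gamma row, to the left and down in a Delta row, so a vertex has
    two inputs and two outputs; an outcome is a weight with the two outputs. In
    this reading every vertex and every crossing has at most two outcomes for
    given inputs, and the Yang-Baxter equations become identities between short
    sums, with an arbitrary function of the outputs. *)
Definition outcomes := seq (F * S * S).

Fixpoint expect (s : outcomes) (k : S -> S -> F) : F :=
  if s is (c, x, y) :: s' then c * k x y + expect s' k else 0.

(** Outputs (right, bottom). *)
Definition gamma_flow z (left top : S) : outcomes :=
  match left, top with
  | None, None => [:: (1, None, None)]
  | None, Some d => [:: (1, Some d, None)]
  | Some c, None => [:: (z, Some c, None); (z, None, Some c)]
  | Some c, Some d =>
      if color_gt c d then [:: (z, Some c, Some d)] else [:: (z, Some d, Some c)]
  end.

(** Outputs (left, bottom). *)
Definition delta_flow z (right top : S) : outcomes :=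
  match right, top with
  | None, None => [:: (z, None, None)]
  | None, Some d => [:: (1, Some d, None)]
  | Some c, None => [:: (1, Some c, None); (z, None, Some c)]
  | Some c, Some d =>
      if color_gt c d then [:: (1, Some d, Some c)] else [:: (1, Some c, Some d)]
  end.

(** Crossing of two Gamma strands, upper one first; inputs on the left, outputs
    on the right, [q] is the quotient of the parameters. *)
Definition gamma_swap q (x y : S) : outcomes :=
  match x, y with
  | None, None => [:: (q, None, None)]
  | None, Some d => [:: (1, None, Some d); (1 - q, Some d, None)]
  | Some c, None => [:: (q, Some c, None)]
  | Some c, Some d =>
      if color_gt d c then [:: (q, Some c, Some d); (1 - q, Some d, Some c)]
      else [:: (1, Some c, Some d)]
  end.

(** Crossing of two Delta strands; inputs on the right, outputs on the left. *)
Definition delta_swap q (x y : S) : outcomes :=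
  match x, y with
  | None, None => [:: (q, None, None)]
  | None, Some d => [:: (q, None, Some d); (1 - q, Some d, None)]
  | Some c, None => [:: (1, Some c, None)]
  | Some c, Some d =>
      if color_gt c d then [:: (q, Some c, Some d); (1 - q, Some d, Some c)]
      else [:: (1, Some c, Some d)]
  end.

(** Crossing of a Gamma strand [y], which enters from the left, with a Delta
    strand [x], which enters from the right; the outputs are the left end of
    the Delta strand and the right end of the Gamma strand. *)
Definition mixed_swap q (y x : S) : outcomes :=
  match y, x with
  | None, None => [:: (q - 1, None, None)]
  | None, Some d => [:: (1, Some d, None); (q, None, Some d)]
  | Some c, None => [:: (1, Some c, None); (1, None, Some c)]
  | Some c, Some d =>
      if color_gt c d then [:: (1, Some d, Some c)] else [:: (1, Some c, Some d)]
  end.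

(** The crossing moves from the right of a column to its left and exchanges the
    two parameters; its weights are found by solving this linear system. *)
Lemma gamma_yang_baxter z1 z2 (l1 l2 t : S) (f : S -> S -> S -> F) : z2 != 0 ->
  expect (gamma_flow z1 l1 t) (fun r1 mu =>
    expect (gamma_flow z2 l2 mu) (fun r2 b =>
      expect (gamma_swap (z1 / z2) r1 r2) (fun s1 s2 => f s1 s2 b)))
  = expect (gamma_swap (z1 / z2) l1 l2) (fun x1 x2 =>
      expect (gamma_flow z2 x1 t) (fun s1 mu =>
        expect (gamma_flow z1 x2 mu) (fun s2 b => f s1 s2 b))).
Proof.
move=> z2n0.
case: l1 => [a|]; case: l2 => [b|]; case: t => [c|] /=;
  flow_cases a b c; first [by field | by bad_order].
Qed.

Lemma delta_yang_baxter z1 z2 (r1 r2 t : S) (f : S -> S -> S -> F) : z2 != 0 ->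
  expect (delta_swap (z1 / z2) r1 r2) (fun x1 x2 =>
    expect (delta_flow z1 x1 t) (fun l1 mu =>
      expect (delta_flow z2 x2 mu) (fun l2 b => f l1 l2 b)))
  = expect (delta_flow z2 r1 t) (fun y1 mu =>
      expect (delta_flow z1 r2 mu) (fun y2 b =>
        expect (delta_swap (z1 / z2) y1 y2) (fun l1 l2 => f l1 l2 b))).
Proof.
move=> z2n0.
case: r1 => [a|]; case: r2 => [b|]; case: t => [c|] /=;
  flow_cases a b c; first [by field | by bad_order].
Qed.

(** The Gamma row is above the Delta row to the left of the crossing and below
    it to the right. The system with the two rows interchanged has only
    degenerate solutions, so this equation can be used in one direction only.
    *)
Lemma mixed_yang_baxter z w (l t r : S) (f : S -> S -> S -> F) : z != 0 ->
  expect (gamma_flow z l t) (fun y mu =>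
    expect (mixed_swap (w / z) y r) (fun x s =>
      expect (delta_flow w x mu) (fun o b => f o b s)))
  = expect (delta_flow w r t) (fun x mu =>
      expect (mixed_swap (w / z) l x) (fun o y =>
        expect (gamma_flow z y mu) (fun s b => f o b s))).
Proof.
move=> zn0.
case: l => [a|]; case: r => [b|]; case: t => [c|] /=;
  flow_cases a b c; first [by field | by bad_order].
Qed.

(** The colour after a U-turn: a barred colour is kept and the others are
    barred. *)
Definition down (c : color n) : color n := (c.1, true).

Definition uturn_value q (y : S) : F := if y is None then q else 1.
Definition uturn_out (y : S) : S := omap down y.

(** Two U-turns, one below the other, seen from rows that have been sorted into
    Gamma, Gamma, Delta, Delta: the sorting leaves one mixed crossing, between
    the lower Gamma strand [y2] and the upper Delta strand. *)
Definition caduceus q k1 k2 (y1 y2 : S) (f : S -> S -> F) : F :=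
  uturn_value k1 y1 * expect (mixed_swap q y2 (uturn_out y1))
    (fun x1 y => uturn_value k2 y * f x1 (uturn_out y)).

(** The right end of the four sorted rows absorbs a crossing of the Gamma
    strands and one of the Delta strands, at the price of exchanging the
    parameters. The weight of the empty U-turn enters through [q], which is 0
    in type C and 1 in type B; the identity holds for every [q]. *)
Lemma caduceus_sym q z1 z2 k1 k2 (y1 y2 : S) (f : S -> S -> F) :
  z1 != 0 -> z2 != 0 ->
  k1 = z1 ^- 2 + q / z1 -> k2 = z2 ^- 2 + q / z2 ->
  expect (gamma_swap (z1 / z2) y1 y2) (fun s1 s2 =>
    caduceus ((z1 * z2)^-1) k2 k1 s1 s2 (fun s3 s4 =>
      expect (delta_swap (z2 / z1) s3 s4) f))
  = caduceus ((z1 * z2)^-1) k1 k2 y1 y2 f.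
Proof.
move=> z1n0 z2n0 -> ->.
have split_ord (i j : 'I_n) : [\/ (i < j)%N = true /\ (j < i)%N = false, i = j
    | (i < j)%N = false /\ (j < i)%N = true].
  by case: ltngtP => H; [apply: Or31|apply: Or33|apply: Or32; apply: val_inj].
case: y1 => [[i bi]|]; case: y2 => [[j bj]|];
  try (case: (split_ord i j) => [[? ?]|?|[? ?]]; subst);
  try (case: bi); try (case: bj).
all: repeat (progress (rewrite /caduceus /= ?color_gtE ?ltnn /=;
    repeat match goal with H : (nat_of_ord ?a < nat_of_ord ?b)%N = _ |- _ =>
      rewrite H end)).
all: try by field; rewrite ?z1n0 ?z2n0.
Qed.
End Flows.

(** * Rows as matrices *)

Section Entries.
Variables (F : fieldType) (n : nat).
Local Notation S := (spin n).
Implicit Types (s : outcomes F n) (k : S -> S -> F).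

Lemma eq_expect s k k' : (forall x y, k x y = k' x y) -> expect s k = expect s k'.
Proof. by move=> E; elim: s => [|[[c x] y] s IH] //=; rewrite E IH. Qed.

Lemma expectZ s a k : expect s (fun x y => a * k x y) = a * expect s k.
Proof.
elim: s => [|[[c x] y] s IH] /=; first by rewrite mulr0.
by rewrite IH mulrDr mulrCA.
Qed.

(** From outcomes back to vertex weights. *)
Definition entry s (x y : S) : F :=
  expect s (fun x' y' => (x' == x)%:R * (y' == y)%:R).

Lemma expectE s k : expect s k = \sum_x \sum_y entry s x y * k x y.
Proof.
rewrite /entry; elim: s => [|[[c x] y] s IH] /=.
  by rewrite big1 // => x _; rewrite big1 // => y _; rewrite mul0r.
rewrite IH.
under [RHS]eq_bigr => x' _.
  under eq_bigr => y' _ do rewrite mulrDl.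
  rewrite big_split; over.
rewrite big_split /=; congr (_ + _).
rewrite (bigD1 x) //= [X in _ = _ + X]big1 ?addr0; last first.
  move=> x' /negPf; rewrite eq_sym => nx.
  by rewrite big1 // => y' _; rewrite nx /= mul0r mulr0 mul0r.
rewrite (bigD1 y) //= [X in _ = _ + X]big1 ?addr0 ?eqxx ?mulr1 //.
by move=> y' /negPf; rewrite eq_sym => ->; rewrite mulr0 mulr0 mul0r.
Qed.

Lemma expect_fst s a (k : S -> F) :
  expect s (fun x y => (x == a)%:R * k y) = \sum_y entry s a y * k y.
Proof.
rewrite expectE (bigD1 a) //= [X in _ + X]big1 ?addr0.
  by apply: eq_bigr => y _; rewrite eqxx mul1r.
by move=> x /negPf nx; rewrite big1 // => y _; rewrite nx mul0r mulr0.
Qed.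

Lemma expect_snd s b (k : S -> F) :
  expect s (fun x y => (y == b)%:R * k x) = \sum_x entry s x b * k x.
Proof.
rewrite expectE; apply: eq_bigr => x _.
rewrite (bigD1 b) //= [X in _ + X]big1 ?addr0 ?eqxx ?mul1r //.
by move=> y /negPf ny; rewrite ny mul0r mulr0.
Qed.

Definition vertex := S -> S -> S -> S -> F.

Definition gamma_vertex z : vertex :=
  fun l t r b => entry (gamma_flow z l t) r b.

Definition delta_vertex z : vertex :=
  fun l t r b => entry (delta_flow z r t) l b.

(** Left and right edges of two rows, one above the other, are pairs; the edge
    between the rows is summed over. *)
Definition column (A B : vertex) (l : S * S) (t b : S) (r : S * S) : F :=
  \sum_mu A l.1 t r.1 mu * B l.2 mu r.2 b.

Definition intertwines (A B A' B' : vertex) (rm : S * S -> S * S -> F) :=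
  forall l t b r, \sum_x column A B l t b x * rm x r =
                  \sum_x rm l x * column A' B' x t b r.

Definition gamma_braid (q : F) (l r : S * S) : F :=
  entry (gamma_swap q l.1 l.2) r.1 r.2.

(** Read from right to left, because Delta strands flow to the left. *)
Definition delta_braid (q : F) (l r : S * S) : F :=
  entry (delta_swap q r.1 r.2) l.1 l.2.

(** Each side of the crossing has one input and one output: on the left the
    upper strand is the Gamma input and the lower one the Delta output, on the
    right the upper strand is the Delta input and the lower one the Gamma
    output. *)
Definition mixed_braid (q : F) (l r : S * S) : F :=
  entry (mixed_swap q l.1 r.1) l.2 r.2.

Lemma sum_pair (k : S * S -> F) : \sum_x k x = \sum_a \sum_b k (a, b).
Proof. by rewrite pair_bigA /=; apply: eq_bigr => -[]. Qed.

(** The form in which the Yang-Baxter equations in terms of outcomes deliver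
    their left and right sides. *)
Lemma column_sum A B l t b (k : S * S -> F) :
  \sum_x column A B l t b x * k x =
  \sum_x1 \sum_mu A l.1 t x1 mu * \sum_x2 B l.2 mu x2 b * k (x1, x2).
Proof.
rewrite sum_pair; apply: eq_bigr => x1 _ /=.
under [RHS]eq_bigr => mu _ do rewrite mulr_sumr.
rewrite exchange_big /=; apply: eq_bigr => x2 _.
by rewrite mulr_suml; apply: eq_bigr => mu _; rewrite mulrA.
Qed.

Lemma gamma_intertwines z1 z2 : z2 != 0 ->
  intertwines (gamma_vertex z1) (gamma_vertex z2)
    (gamma_vertex z2) (gamma_vertex z1) (gamma_braid (z1 / z2)).
Proof.
move=> z2n0 [l1 l2] t b [r1 r2]; rewrite column_sum sum_pair.
have := gamma_yang_baxter z1 l1 l2 t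
  (fun u1 u2 b' => (b' == b)%:R * ((u1 == r1)%:R * (u2 == r2)%:R)) z2n0.
under eq_expect => x mu.
  under eq_expect => x2 b' do rewrite expectZ.
  rewrite expect_snd; over.
under [in X in _ = X -> _]eq_expect => x1 x2.
  under eq_expect => u1 mu.
    under eq_expect => u2 b' do rewrite mulrCA.
    rewrite expectZ; under eq_expect => u2 b' do rewrite mulrC.
    rewrite -/(entry _ _ _); over.
  rewrite expect_fst; over.
by rewrite 2!expectE.
Qed.

Lemma delta_intertwines z1 z2 : z2 != 0 ->
  intertwines (delta_vertex z1) (delta_vertex z2)
    (delta_vertex z2) (delta_vertex z1) (delta_braid (z1 / z2)).
Proof.
move=> z2n0 [l1 l2] t b [r1 r2].
under [RHS]eq_bigr => x _ do rewrite mulrC.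
have := delta_yang_baxter z1 r1 r2 t
  (fun u1 u2 b' => (b' == b)%:R * ((u1 == l1)%:R * (u2 == l2)%:R)) z2n0.
under eq_expect => x1 x2.
  under eq_expect => u1 mu.
    under eq_expect => u2 b' do rewrite mulrCA.
    rewrite expectZ; under eq_expect => u2 b' do rewrite mulrC.
    rewrite -/(entry _ _ _); over.
  rewrite expect_fst; over.
under [in X in _ = X -> _]eq_expect => x mu.
  under eq_expect => x2 b' do rewrite expectZ.
  rewrite expect_snd; over.
rewrite 2!expectE => E.
rewrite sum_pair; etransitivity; last (etransitivity; first exact: E).
  by apply: eq_bigr => x1 _; apply: eq_bigr => x2 _; rewrite mulrC.
rewrite sum_pair; apply: eq_bigr => x1 _.
under eq_bigr => mu _ do rewrite mulr_sumr.
rewrite exchange_big /=; apply: eq_bigr => x2 _.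
by rewrite mulr_suml; apply: eq_bigr => mu _; rewrite mulrA.
Qed.

Lemma mixed_intertwines z w : z != 0 ->
  intertwines (gamma_vertex z) (delta_vertex w)
    (delta_vertex w) (gamma_vertex z) (mixed_braid (w / z)).
Proof.
move=> zn0 [l1 l2] t b [r1 r2]; rewrite column_sum.
have := mixed_yang_baxter w l1 t r1
  (fun u b' v => (u == l2)%:R * ((b' == b)%:R * (v == r2)%:R)) zn0.
under eq_expect => x mu.
  under eq_expect => u v.
    under eq_expect => u' b' do rewrite mulrA mulrC.
    rewrite expectZ -/(entry _ _ _); over.
  rewrite expect_snd; over.
under [in X in _ = X -> _]eq_expect => x mu.
  under eq_expect => u y.
    rewrite expectZ; under eq_expect => v b' do rewrite mulrC.
    rewrite -/(entry _ _ _); over.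
  rewrite expect_fst; over.
rewrite 2!expectE => E.
rewrite sum_pair; etransitivity; last (etransitivity; first exact: E).
  apply: eq_bigr => x1 _; apply: eq_bigr => mu _; congr (_ * _).
  by apply: eq_bigr => x2 _; rewrite mulrC.
apply: eq_bigr => x1 _.
under eq_bigr => mu _ do rewrite mulr_sumr.
rewrite exchange_big /=; apply: eq_bigr => x2 _.
by rewrite mulr_sumr; apply: eq_bigr => mu _; rewrite mulrCA.
Qed.

Fixpoint line (A : vertex) (l : S) (ts bs : seq S) (r : S) : F :=
  match ts, bs with
  | [::], [::] => (l == r)%:R
  | t :: ts', b :: bs' => \sum_x A l t x b * line A x ts' bs' r
  | _, _ => 0
  end.

Lemma big_tuple_cons (T : finType) m (G : m.+1.-tuple T -> F) :
  \sum_(u : m.+1.-tuple T) G u = \sum_x \sum_(v : m.-tuple T) G [tuple of x :: v].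
Proof.
rewrite pair_bigA /=.
rewrite (reindex (fun p : T * m.-tuple T => [tuple of p.1 :: p.2])) //=.
exists (fun u => (thead u, [tuple of behead u])) => [[x v] _ | u _] /=.
  by congr pair; apply: val_inj.
by rewrite -tuple_eta.
Qed.

Definition lines (A B : vertex) (m : nat) (l : S * S) ts bs (r : S * S) : F :=
  \sum_(mu : m.-tuple S) line A l.1 ts mu r.1 * line B l.2 mu bs r.2.

Lemma lines_nil A B l r :
  lines A B 0 l [::] [::] r = (l == r)%:R.
Proof.
rewrite /lines (big_pred1 [tuple]) /= => [|u]; last by rewrite [u]tuple0 /= eqxx.
by case: l r => [l1 l2] [r1 r2]; rewrite -natrM mulnb.
Qed.

Lemma lines_cons A B m l t ts b bs r :
  lines A B m.+1 l (t :: ts) (b :: bs) r =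
  \sum_x column A B l t b x * lines A B m x ts bs r.
Proof.
rewrite /lines big_tuple_cons column_sum [RHS]exchange_big /=.
apply: eq_bigr => mu _.
under eq_bigr => v _ do rewrite mulr_suml.
rewrite exchange_big /=; apply: eq_bigr => x1 _.
under eq_bigr => v _ do rewrite -mulrA.
rewrite -mulr_sumr; congr (_ * _) => /=.
under eq_bigr => v _ do rewrite mulr_sumr.
rewrite exchange_big /=; apply: eq_bigr => x2 _.
by rewrite mulr_sumr; apply: eq_bigr => v _; rewrite mulrCA.
Qed.

(** The crossing is pulled through one column at a time. *)
Lemma intertwines_lines A B A' B' rm m : intertwines A B A' B' rm ->
  forall (ts bs : m.-tuple S) l r,
    \sum_x lines A B m l ts bs x * rm x r = \sum_x rm l x * lines A' B' m x ts bs r.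
Proof.
move=> AB; elim: m => [|m IH] ts bs l r.
  rewrite [ts]tuple0 [bs]tuple0.
  under eq_bigr => x _ do rewrite lines_nil.
  under [RHS]eq_bigr => x _ do rewrite lines_nil.
  rewrite (bigD1 l) //= eqxx mul1r big1 ?addr0 => [|x /negPf nx]; last first.
    by rewrite eq_sym nx mul0r.
  by rewrite (bigD1 r) //= eqxx mulr1 big1 ?addr0 // => x /negPf ->; rewrite mulr0.
case/tupleP: ts => t ts; case/tupleP: bs => b bs /=.
under eq_bigr => x _ do rewrite lines_cons mulr_suml.
rewrite exchange_big /=.
under [RHS]eq_bigr => x _ do rewrite lines_cons mulr_sumr.
rewrite [RHS]exchange_big /=.
transitivity (\sum_x column A B l t b x * \sum_y rm x y * lines A' B' m y ts bs r).
  apply: eq_bigr => x _; rewrite -IH mulr_sumr.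
  by apply: eq_bigr => y _; rewrite mulrA.
under [LHS]eq_bigr => x _ do rewrite mulr_sumr.
rewrite exchange_big /=; apply: eq_bigr => y _.
under eq_bigr => x _ do rewrite mulrA.
rewrite -mulr_suml AB mulr_suml.
by apply: eq_bigr => x _; rewrite mulrA.
Qed.

Section Matrices.
Variable m : nat.
Local Notation N := #|{: m.-tuple S}|.

Definition spins_of (i : 'I_N) : m.-tuple S := enum_val i.

Definition line_mx (A : vertex) (l r : S) : 'M[F]_N :=
  \matrix_(i, j) line A l (spins_of i) (spins_of j) r.

Lemma line_mxM A B l1 r1 l2 r2 i j :
  (line_mx A l1 r1 *m line_mx B l2 r2) i j =
  lines A B m (l1, l2) (spins_of i) (spins_of j) (r1, r2).
Proof.
rewrite mxE /lines [RHS](reindex_omap spins_of (fun x => Some (enum_rank x))) /=.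
  apply: eq_big => [k|k _]; last by rewrite !mxE.
  by rewrite enum_valK eqxx.
by move=> x _; rewrite /spins_of enum_rankK.
Qed.

Lemma intertwines_mx A B A' B' rm l r : intertwines A B A' B' rm ->
  \sum_x rm x r *: (line_mx A l.1 x.1 *m line_mx B l.2 x.2) =
  \sum_x rm l x *: (line_mx A' x.1 r.1 *m line_mx B' x.2 r.2).
Proof.
move=> AB; apply/matrixP => i j; rewrite !summxE.
under eq_bigr => x _ do rewrite mxE line_mxM mulrC.
under [RHS]eq_bigr => x _ do rewrite mxE line_mxM.
case: l => l1 l2; case: r => r1 r2.
rewrite -(intertwines_lines AB).
by apply: eq_bigr => -[x1 x2].
Qed.

End Matrices.
End Entries.

(** * Exchange of two neighbouring row pairs *)

Section RowPairs.
Variables (F : fieldType) (n m : nat).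
Local Notation S := (spin n).
Local Notation N := #|{: m.-tuple S}|.
Implicit Types (z : F).

Definition gamma_mx z (y : S) : 'M[F]_N := line_mx m (gamma_vertex z) None y.
Definition delta_mx z (a : color n) (x : S) : 'M[F]_N :=
  line_mx m (delta_vertex z^-1) (Some a) x.

Definition pair_mx (k z : F) (a : color n) : 'M[F]_N :=
  \sum_y uturn_value k y *: (gamma_mx z y *m delta_mx z a (uturn_out y)).

(** On the left the Gamma strand is empty and the Delta strand ends in [a]. The
    only configuration of the mixed crossing with these two ends lets both
    strands pass, with weight 1; so after pulling the crossing to the left a
    single term remains, the Delta row over the Gamma row. *)
Lemma mixed_exchange z1 z2 a x y : z2 != 0 ->
  delta_mx z1 a x *m gamma_mx z2 y =
  \sum_u \sum_v entry (mixed_swap (z1 * z2)^-1 v x) u y *: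
    (gamma_mx z2 v *m delta_mx z1 a u).
Proof.
move=> z2n0.
have /= := intertwines_mx m (None, Some a) (x, y) (@mixed_intertwines _ n z2 z1^-1 z2n0).
rewrite -invfM /mixed_braid /= => E.
transitivity (\sum_v \sum_u entry (mixed_swap (z1 * z2)^-1 v x) u y *:
    (gamma_mx z2 v *m delta_mx z1 a u)); last exact: exchange_big.
rewrite pair_bigA /= [RHS]E (bigD1 (Some a, None)) //= [X in _ + X]big1 ?addr0.
  have -> : entry (mixed_swap (z1 * z2)^-1 None (Some a)) (Some a) None = 1 :> F.
    by rewrite /entry /= ?eqxx /=; ring.
  by rewrite scale1r.
move=> [c v] nx.
suff -> : entry (mixed_swap (z1 * z2)^-1 None c) (Some a) v = 0 by rewrite scale0r.
move: nx; rewrite /entry; case: c => [c|] nx /=; last by ring.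
suff -> : (Some c == Some a)%:R * (None == v)%:R = 0 :> F by ring.
by rewrite -natrM mulnb [None == v]eq_sym -xpair_eqE (negPf nx).
Qed.

Lemma caduceusE q k1 k2 y1 y2 (f : S -> S -> F) :
  caduceus q k1 k2 y1 y2 f = \sum_u \sum_v
    uturn_value k1 y1 * (uturn_value k2 v * entry (mixed_swap q y2 (uturn_out y1)) u v) *
    f u (uturn_out v).
Proof.
rewrite /caduceus expectE mulr_sumr; apply: eq_bigr => u _.
by rewrite mulr_sumr; apply: eq_bigr => v _; ring.
Qed.

(** Matrix entries of four rows sorted into Gamma, Gamma, Delta, Delta, as
    functions of the spins at their right ends. *)
Definition four_rows z1 z2 a b i j (y1 y2 x1 x2 : S) : F :=
  ((gamma_mx z1 y1 *m gamma_mx z2 y2) *m (delta_mx z1 a x1 *m delta_mx z2 b x2)) i j.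

(** The U-turn of the upper pair and the Gamma row of the lower pair meet in
    one mixed crossing, which sorts the rows. *)
Lemma pair_mxM k1 k2 z1 z2 a b i j : z2 != 0 ->
  (pair_mx k1 z1 a *m pair_mx k2 z2 b) i j =
  \sum_y1 \sum_y2 caduceus (z1 * z2)^-1 k1 k2 y1 y2 (four_rows z1 z2 a b i j y1 y2).
Proof.
move=> z2n0.
rewrite /pair_mx mulmx_suml summxE; apply: eq_bigr => y1 _.
rewrite mulmx_sumr summxE.
under eq_bigr => y _.
  rewrite -scalemxAl -scalemxAr mulmxA -(mulmxA (gamma_mx _ _)) mixed_exchange //.
  rewrite mulmx_sumr mulmx_suml 2!scaler_sumr summxE.
  under eq_bigr => u _.
    rewrite mulmx_sumr mulmx_suml 2!scaler_sumr summxE.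
    under eq_bigr => v _ do rewrite -scalemxAr -scalemxAl !mxE /=.
    over.
  rewrite exchange_big; over.
rewrite exchange_big /=; apply: eq_bigr => y2 _.
rewrite /caduceus expectE mulr_sumr exchange_big /=; apply: eq_bigr => u _.
rewrite mulr_sumr; apply: eq_bigr => y _.
rewrite /four_rows !mulmxA.
by rewrite [in RHS]mxE mulrCA.
Qed.

(** Both left edges are empty, where the crossing is the scalar z1/z2. *)
Lemma gamma_exchange z1 z2 y1 y2 : z1 != 0 -> z2 != 0 ->
  gamma_mx z2 y1 *m gamma_mx z1 y2 =
  (z2 / z1) *: \sum_u \sum_v entry (gamma_swap (z1 / z2) u v) y1 y2 *:
    (gamma_mx z1 u *m gamma_mx z2 v).
Proof.
move=> z1n0 z2n0.
have /= := intertwines_mx m (None, None) (y1, y2) (@gamma_intertwines _ n z1 z2 z2n0).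
rewrite /gamma_braid pair_bigA /= => ->.
rewrite (bigD1 (None, None)) //= [X in _ + X]big1 ?addr0.
  have -> : entry (gamma_swap (z1 / z2) None None) (@None (color n)) None = z1 / z2.
    by rewrite /entry /= ?eqxx /=; ring.
  rewrite scalerA; have -> : z2 / z1 * (z1 / z2) = 1 by field; rewrite ?z1n0 ?z2n0.
  by rewrite scale1r.
move=> [u v] nx.
suff -> : entry (gamma_swap (z1 / z2) None None) u v = 0 by rewrite scale0r.
rewrite /entry /=; suff -> : (None == u)%:R * (None == v)%:R = 0 :> F by ring.
by rewrite -natrM mulnb [None == v]eq_sym [None == u]eq_sym -xpair_eqE (negPf nx).
Qed.

(** On the left edges (a, b) with a < b the crossing either lets the colours
    pass or exchanges them; this is the only place where the order of the exit
    colours matters. *)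
Lemma delta_exchange z1 z2 a b x1 x2 : z1 != 0 -> z2 != 0 -> color_gt b a ->
  \sum_u \sum_v entry (delta_swap (z2 / z1) x1 x2) u v *:
    (delta_mx z1 a u *m delta_mx z2 b v) =
  delta_mx z2 a x1 *m delta_mx z1 b x2 +
  (1 - z2 / z1) *: (delta_mx z2 b x1 *m delta_mx z1 a x2).
Proof.
move=> z1n0 z2n0 ab.
have z2Vn0 : z2^-1 != 0 by rewrite invr_eq0.
have /= := intertwines_mx m (Some a, Some b) (x1, x2) (@delta_intertwines _ n z1^-1 z2^-1 z2Vn0).
rewrite /delta_braid /= invrK [_^-1 * _]mulrC pair_bigA /= => ->.
have anb : a != b by apply: contraTneq ab => ->; rewrite color_gtxx.
have abF : color_gt a b = false.
  by apply/negP; move: ab; rewrite /color_gt => ab ba; have := ltn_trans ab ba; rewrite ltnn.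
rewrite (bigD1 (Some a, Some b)) //= (bigD1 (Some b, Some a)) /=; last first.
  by rewrite xpair_eqE /= !(inj_eq Some_inj) [b == a]eq_sym (negPf anb).
rewrite [X in _ + (_ + X)]big1 ?addr0.
  have -> : entry (delta_swap (z2 / z1) (Some a) (Some b)) (Some a) (Some b) = 1.
    by rewrite /entry /= abF /= !eqxx /=; ring.
  have -> : entry (delta_swap (z2 / z1) (Some b) (Some a)) (Some a) (Some b) = 1 - z2 / z1.
    by rewrite /entry /= ab /= !(inj_eq Some_inj) !eqxx [b == a]eq_sym (negPf anb) /=; ring.
  by rewrite scale1r.
move=> [u v] /andP[nab nba].
suff -> : entry (delta_swap (z2 / z1) u v) (Some a) (Some b) = 0 by rewrite scale0r.
move: nab nba; rewrite /entry !xpair_eqE; case: u => [u|]; case: v => [v|] /=; try (move=> *; ring).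
rewrite !(inj_eq Some_inj) => /negPf nab /negPf nba.
have E c d : (u == c) && (v == d) = false -> (Some u == Some c)%:R * (Some v == Some d)%:R = 0 :> F.
  by rewrite -natrM mulnb !(inj_eq Some_inj) => ->.
case: (color_gt u v) => /=; rewrite E //; last by ring.
have -> : (Some v == Some a)%:R * (Some u == Some b)%:R = 0 :> F by rewrite mulrC E.
by ring.
Qed.

(** The divided-difference equation for two neighbouring row pairs. After
    sorting, both sides are sums over the right ends of the same four rows, and
    the coefficients agree by [caduceus_sym]. *)
Lemma pair_exchange q k1 k2 z1 z2 a b :
  z1 != 0 -> z2 != 0 -> color_gt b a ->
  k1 = z1 ^- 2 + q / z1 -> k2 = z2 ^- 2 + q / z2 ->
  z2 *: (pair_mx k1 z1 a *m pair_mx k2 z2 b) =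
  z1 *: (pair_mx k2 z2 a *m pair_mx k1 z1 b) +
  (z1 - z2) *: (pair_mx k2 z2 b *m pair_mx k1 z1 a).
Proof.
move=> z1n0 z2n0 ab k1E k2E; apply/matrixP => i j.
have Z c (A : 'M[F]_N) : (c *: A) i j = c * A i j by rewrite mxE.
have D (A B : 'M[F]_N) : (A + B) i j = A i j + B i j by rewrite mxE.
rewrite D !Z.
(* The two crossings that exchange the parameters, written on the right ends. *)
have delta_sum y1 y2 x1 x2 :
    four_rows z2 z1 a b i j y1 y2 x1 x2 + (1 - z2 / z1) * four_rows z2 z1 b a i j y1 y2 x1 x2 =
    z2 / z1 * \sum_u \sum_v entry (gamma_swap (z1 / z2) u v) y1 y2 *
      expect (delta_swap (z2 / z1) x1 x2) (four_rows z1 z2 a b i j u v).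
  rewrite /four_rows -Z scalemxAr -D -mulmxDr -delta_exchange // gamma_exchange //.
  rewrite -scalemxAl Z; congr (_ * _).
  rewrite mulmx_suml summxE; apply: eq_bigr => u _.
  rewrite mulmx_suml summxE; apply: eq_bigr => v _.
  rewrite -scalemxAl Z expectE; congr (_ * _).
  rewrite mulmx_sumr summxE; apply: eq_bigr => x _.
  rewrite mulmx_sumr summxE; apply: eq_bigr => y _.
  by rewrite -scalemxAr Z.
have M_sum : (pair_mx k2 z2 a *m pair_mx k1 z1 b) i j +
    (1 - z2 / z1) * (pair_mx k2 z2 b *m pair_mx k1 z1 a) i j =
    z2 / z1 * (pair_mx k1 z1 a *m pair_mx k2 z2 b) i j; last first.
  rewrite (_ : z2 * _ = z1 * (z2 / z1 * (pair_mx k1 z1 a *m pair_mx k2 z2 b) i j)).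
    by rewrite -M_sum; field.
  by field.
rewrite !pair_mxM // mulr_sumr -big_split /=.
under eq_bigr => y1 _.
  rewrite mulr_sumr -big_split /=.
  under eq_bigr => y2 _.
    have -> : caduceus (z2 * z1)^-1 k2 k1 y1 y2 (four_rows z2 z1 a b i j y1 y2) +
       (1 - z2 / z1) * caduceus (z2 * z1)^-1 k2 k1 y1 y2 (four_rows z2 z1 b a i j y1 y2) =
       z2 / z1 * \sum_u \sum_v entry (gamma_swap (z1 / z2) u v) y1 y2 *
         caduceus (z1 * z2)^-1 k2 k1 y1 y2 (fun x1 x2 =>
           expect (delta_swap (z2 / z1) x1 x2) (four_rows z1 z2 a b i j u v)).
      rewrite [z2 * z1]mulrC !caduceusE mulr_sumr -big_split /=.
      under [in RHS]eq_bigr => u _.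
        under eq_bigr => v _.
          rewrite caduceusE mulr_sumr.
          under eq_bigr => x _ do rewrite mulr_sumr.
          over.
        rewrite exchange_big /=; under eq_bigr => x _ do rewrite exchange_big /=.
        over.
      rewrite exchange_big mulr_sumr /=; apply: eq_bigr => x _.
      rewrite exchange_big mulr_sumr -big_split /= mulr_sumr; apply: eq_bigr => y _.
      rewrite [(1 - _) * (_ * _)]mulrCA -mulrDr delta_sum mulrCA; congr (_ * _).
      rewrite mulr_sumr; apply: eq_bigr => u _.
      by rewrite mulr_sumr; apply: eq_bigr => v _; rewrite mulrCA.
    over.
  rewrite -mulr_sumr exchange_big; over.
rewrite -mulr_sumr exchange_big; congr (_ * _); apply: eq_bigr => u _ /=.
under eq_bigr => y1 _ do rewrite exchange_big /=.
rewrite exchange_big; apply: eq_bigr => v _ /=.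
rewrite -(@caduceus_sym F n q z1 z2 k1 k2 _ _ _ z1n0 z2n0 k1E k2E).
by rewrite expectE.
Qed.
End RowPairs.

(** * Row pairs read column by column *)

Section Columns.
Variables (F : fieldType) (n : nat).
Local Notation S := (spin n).
Implicit Types (k z w d : F).

(** A row pair with arbitrary left edges [l], which makes recursion on the
    columns from left to right possible. *)
Definition turn_lines (k z : F) (l : S * S) (ts bs : seq S) : F :=
  \sum_y uturn_value k y *
    lines (gamma_vertex z) (delta_vertex z^-1) (size ts) l ts bs (y, uturn_out y).

Lemma pair_mxE m k z a i j :
  pair_mx m k z a i j = turn_lines k z (None, Some a) (spins_of i) (@spins_of n m j).
Proof.
rewrite /pair_mx summxE /turn_lines size_tuple.
by apply: eq_bigr => y _; rewrite mxE line_mxM.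
Qed.

Lemma turn_lines_cons k z l t ts b bs :
  turn_lines k z l (t :: ts) (b :: bs) =
  expect (gamma_flow z l.1 t) (fun x mu =>
    \sum_y delta_vertex z^-1 l.2 mu y b * turn_lines k z (x, y) ts bs).
Proof.
rewrite /turn_lines /= expectE.
under eq_bigr => y _ do rewrite lines_cons mulr_sumr.
rewrite exchange_big /=.
under eq_bigr => x _.
  under eq_bigr => y _ do rewrite mulrCA.
  rewrite -mulr_sumr; over.
by rewrite column_sum.
Qed.

Lemma turn_lines_nil k z l :
  turn_lines k z l [::] [::] = uturn_value k l.1 * (uturn_out l.1 == l.2)%:R.
Proof.
rewrite /turn_lines /= (bigD1 l.1) //= big1 ?addr0 => [|y ny]; rewrite lines_nil.
  by case: l => l1 l2; rewrite xpair_eqE eqxx [_ == l2]eq_sym.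
by case: l ny => l1 l2 /= /negPf ny; rewrite xpair_eqE eq_sym ny mulr0.
Qed.

(** A colour that arrives at the left edge of a Delta row and is smaller than
    what comes from above has passed straight through. *)
Lemma delta_sum_pass w a mu b (h : S -> F) :
  (if mu is Some d then color_gt d a else true) ->
  \sum_y delta_vertex w (Some a) mu y b * h y = (mu == b)%:R * h (Some a).
Proof.
move=> amu; rewrite (bigD1 (Some a)) //= [X in _ + X]big1 ?addr0.
  congr (_ * _); rewrite /delta_vertex /entry; case: mu amu => [d|] da /=.
    have -> : color_gt a d = false.
      by apply/negP; move: da; rewrite /color_gt => ad g; have := ltn_trans ad g; rewrite ltnn.
    by rewrite /= eqxx /=; ring.
  by rewrite eqxx /=; ring.
move=> y ny; suff -> : delta_vertex w (Some a) mu y b = 0 by rewrite mul0r.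
have nya e : Some e != Some a -> (Some e == Some a) = false by apply: negbTE.
rewrite /delta_vertex /entry; case: mu amu => [d|] da; case: y ny => [e|] ny /=.
- case: ifP => ed /=; last by rewrite nya //=; ring.
  have -> : (Some d == Some a) = false.
    by apply/eqP => -[E]; move: da; rewrite E color_gtxx.
  by rewrite /=; ring.
- have -> : (Some d == Some a) = false.
    by apply/eqP => -[E]; move: da; rewrite E color_gtxx.
  by rewrite /=; ring.
- by rewrite nya //=; ring.
- by ring.
Qed.

Lemma delta_sum_exit w a c (h : S -> F) :
  \sum_y delta_vertex w (Some a) (Some c) y None * h y = (c == a)%:R * h None.
Proof.
rewrite (bigD1 None) //= [X in _ + X]big1 ?addr0.
  by congr (_ * _); rewrite /delta_vertex /entry /= (inj_eq Some_inj); ring.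
move=> [e|] // _; rewrite /delta_vertex /entry /=.
by case: ifP => _ /=; ring.
Qed.

Lemma delta_sum_none w mu (h : S -> F) :
  \sum_y delta_vertex w None mu y None * h y = (mu == None)%:R * (w * h None).
Proof.
rewrite (bigD1 None) //= [X in _ + X]big1 ?addr0.
  by rewrite /delta_vertex /entry; case: mu => [d|] /=; ring.
move=> [e|] // _; rewrite /delta_vertex /entry; case: mu => [d|] /=; last by ring.
by case: ifP => _ /=; ring.
Qed.

Definition all_empty (ts : seq S) := all (pred1 None) ts.

Local Notation drain k z l ts := (turn_lines k z l ts (nseq (size ts) None)).

(** With empty bottom edges, a Delta row that is empty at one edge is empty
    from there to the U-turn, so a colour in the Gamma row above has nowhere to
    go. *)
Lemma drain_dead k z c ts : drain k z (Some c, None) ts = 0.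
Proof.
elim: ts => [|t ts IH] /=; first by rewrite turn_lines_nil /= mulr0.
rewrite turn_lines_cons; case: t => [d|] /=.
  by case: ifP => _ /=; rewrite delta_sum_none /=; ring.
by rewrite !delta_sum_none /= IH; ring.
Qed.

Lemma drain_none k z ts :
  drain k z (None, None) ts = (all_empty ts)%:R * (k * z ^- size ts).
Proof.
elim: ts => [|t ts IH] /=; first by rewrite turn_lines_nil /= expr0 invr1; ring.
rewrite turn_lines_cons; case: t => [d|] /=; rewrite delta_sum_none /=.
  by rewrite drain_dead; ring.
by rewrite IH exprS invfM; ring.
Qed.

(** Either the colour [c] runs to the U-turn, which gives the first term, or it
    drops into the Delta row and leaves as [c = a]. The second possibility is a
    geometric sum over the column of the drop; [d] is the denominator that sums
    it. *)
Lemma drain_some k z d c a ts : z != 0 -> k * d = 1 - z ^- 2 ->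
  drain k z (Some c, Some a) ts * d =
  (all_empty ts)%:R * ((a == down c)%:R * z ^+ size ts * d +
                   (c == a)%:R * (z ^+ size ts - z ^- size ts)).
Proof.
move=> z0 kd; elim: ts => [|t ts IH] /=.
  rewrite turn_lines_nil /= (inj_eq Some_inj) [down c == a]eq_sym expr0 invr1; ring.
rewrite turn_lines_cons; case: t => [e|] /=.
  by case: ifP => _ /=; rewrite delta_sum_exit drain_dead; ring.
rewrite delta_sum_pass // delta_sum_exit drain_none /=.
rewrite addr0 mulrDl -!mulrA -mulrDr mul1r mulrDr IH.
have -> : k * (z ^- size ts * d) = (1 - z ^- 2) * z ^- size ts by rewrite mulrCA kd mulrC.
rewrite !exprS expr0; move: (z ^+ size ts) (expf_neq0 (size ts) z0) => A A0.
by field; rewrite ?A0 ?z0.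
Qed.

(** The divided-difference equation for the last row pair. If the entering
    colour is c_i, the states on the right pass through the U-turn and those on
    the left do not: a geometric sum against its two extreme terms. If it is
    the bar of c_i, the left side vanishes and the right side is the difference
    of two equal sums; this is what the condition on [d + d' + d * d'] says. *)
Lemma drain_reflect k k' z d d' i ts :
  z != 0 -> d != 0 -> d' != 0 ->
  k * d = 1 - z ^- 2 -> k' * d' = 1 - z ^+ 2 -> d + d' + d * d' = 0 ->
  drain k z (None, Some (i, false)) ts * d =
  drain k z (None, Some (i, true)) ts - drain k' z^-1 (None, Some (i, true)) ts.
Proof.
move=> z0 d0 d'0 kd kd' dd'; elim: ts => [|t ts IH] /=.
  by rewrite !turn_lines_nil /=; ring.
rewrite !turn_lines_cons; case: t => [c|] /=; rewrite !delta_sum_pass //=; last first.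
  by rewrite !mul1r !addr0 IH.
rewrite !mul1r !addr0 (drain_some _ _ _ z0 kd).
have kd2 : k' * d' = 1 - z^-1 ^- 2 by rewrite exprVn invrK.
have zV0 : z^-1 != 0 by rewrite invr_eq0.
have := drain_some c (i, true) ts zV0 kd2.
have := drain_some c (i, true) ts z0 kd.
move: (drain k z _ _) (drain k' z^-1 _ _) => A B EA EB.
have -> : A = A * d / d by rewrite mulfK.
have -> : B = B * d' / d' by rewrite mulfK.
rewrite {}EA {}EB exprVn invrK.
(* A barred entering colour comes first. *)
case: c => [j [|]]; rewrite /down !xpair_eqE /= ?andbF ?andbT.
  rewrite [j == i]eq_sym; case: (i == j) => /=; last by ring.
  move: (z ^+ size ts) (z ^- size ts) => A' B'.
  transitivity ((all_empty ts)%:R * (A' - B') * (d + d' + d * d') / (d * d')).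
    by rewrite dd'; ring.
  by field; rewrite d0 d'0.
rewrite [j == i]eq_sym; case: (i == j) => /=; last by ring.
by move: (z ^+ size ts) (z ^- size ts) => A' B'; field; rewrite ?d0 ?d'0.
Qed.

Definition plain (c : color n) := ~~ c.2.
Definition plain_spin (x : S) := if x is Some c then plain c else true.

Lemma plain_gt_barred c i : plain c -> color_gt c (i, true).
Proof. by case: c => j [|] //=; rewrite color_gtE. Qed.

(** The colour [c] has to reach the U-turn in order to exit as its bar, and
    U-turns are the only source of barred colours. *)
Lemma turn_lines_lost k z c l ts bs : size bs = size ts -> plain_spin l ->
  l != Some c -> all plain_spin ts -> Some c \notin ts -> plain c ->
  turn_lines k z (l, Some (down c)) ts bs = 0.
Proof.
move=> sz; elim: ts bs sz l => [|t ts IH] [|b bs] //= => [_|[sz]] l pl lc.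
  move=> _ _ pc; rewrite turn_lines_nil /=.
  case: l pl lc => [[i [|]]|] //= _ lc; last by rewrite mulr0.
  case: c pc lc => j [|] //= _.
  rewrite !(inj_eq Some_inj) /down /= !xpair_eqE !andbT => /negPf ->.
  by rewrite mulr0.
case/andP => pt pts; rewrite inE negb_or eq_sym => /andP[tc cts] pc.
have step x mu : plain_spin x -> x != Some c -> plain_spin mu ->
    \sum_y delta_vertex z^-1 (Some (down c)) mu y b * turn_lines k z (x, y) ts bs = 0.
  move=> px xc pmu; rewrite delta_sum_pass ?IH ?mulr0 //.
  by case: mu pmu => [mu|] // pmu; apply: plain_gt_barred.
rewrite turn_lines_cons; case: l pl lc => [e|] pl lc; case: t pt tc => [g|] pt tc //=.
- by case: ifP => _ /=; rewrite step //; ring.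
- by rewrite !step //; ring.
- by rewrite step //; ring.
- by rewrite step //; ring.
Qed.

(** By [turn_lines_lost] the largest colour, once in the Gamma row, must stay
    there up to the U-turn, and its bar, the exit colour, is smaller than every
    colour it crosses on the way back; so all vertices are forced. *)
Lemma turn_lines_carry k z c ts bs : size bs = size ts -> plain c ->
  all (fun t => if t is Some e then plain e && color_gt c e else true) ts ->
  turn_lines k z (Some c, Some (down c)) ts bs = (ts == bs)%:R * z ^+ size ts.
Proof.
move=> sz pc; elim: ts bs sz => [|t ts IH] [|b bs] //= => [_ _|[sz]].
  by rewrite turn_lines_nil /= eqxx /=; ring.
case/andP => ct cts; rewrite turn_lines_cons eqseq_cons.
have pts : all plain_spin ts by apply: sub_all cts => -[e /andP[]|].
have cnts : Some c \notin ts.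
  by apply/negP => /(allP cts) /andP[_]; rewrite color_gtxx.
case: t ct => [e|] /= ce.
  case/andP: ce => pe ce; rewrite ce /= delta_sum_pass ?IH //; last exact: plain_gt_barred.
  by rewrite -mulnb natrM exprS; ring.
rewrite !delta_sum_pass ?IH //; last exact: plain_gt_barred.
rewrite turn_lines_lost // -mulnb natrM exprS; ring.
Qed.

Lemma turn_lines_first k z c p ts bs : size bs = (p + (size ts).+1)%N -> plain c ->
  all (fun t => if t is Some e then plain e && color_gt c e else true) ts ->
  turn_lines k z (None, Some (down c)) (nseq p None ++ Some c :: ts) bs =
  (nseq p None ++ None :: ts == bs)%:R * z ^+ size ts.
Proof.
move=> sz pc cts; elim: p bs sz => [|p IH] [|b bs] //= [sz]; rewrite turn_lines_cons /=.
  rewrite delta_sum_pass // turn_lines_carry // eqseq_cons -mulnb natrM; ring.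
rewrite delta_sum_pass // IH // eqseq_cons -mulnb natrM; ring.
Qed.
End Columns.

(** * Substitutions of variables in rational functions *)

Section Substitution.
Variables (R : idomainType) (n : nat).
Local Notation A := {mpoly R[n]}.
Local Notation K := (ratfun R n).
Local Notation frac := (@FracField.tofrac A).

(** A name for this instance of [mmap], so that inference finds its morphism
    structure. *)
Definition eval_at (v : 'I_n -> K) (p : A) : K := mmap (frac \o @mpolyC n R) v p.

HB.instance Definition _ v := GRing.RMorphism.copy (eval_at v)
  (mmap (frac \o @mpolyC n R) v).

Lemma ratio_repr (f : K) :
  let r := generic_quotient.repr f in f = frac \n_r / frac \d_r.
Proof.
set r := generic_quotient.repr f => /=.
have d0 : \d_r != 0 by apply: denom_ratioP.
apply: (canRL (mulfK _)); first by rewrite tofrac_eq0.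
have -> : f = (\pi_(FracField.type A) r)%qT by rewrite /r generic_quotient.reprK.
unlock FracField.tofrac; rewrite -[LHS]FracField.pi_mul.
apply/generic_quotient.eqmodP/eqP.
by rewrite /FracField.mulf /= !numden_Ratio ?mulr1 // ?oner_eq0 // mulrC.
Qed.

(** The chosen representative of a fraction does not matter as soon as no
    denominator is killed. *)
Lemma substitute_ratio v p q : (forall u, u != 0 -> eval_at v u != 0) -> q != 0 ->
  substitute v (frac p / frac q) = eval_at v p / eval_at v q.
Proof.
move=> inj q0; set f := frac p / frac q.
rewrite /substitute -/(eval_at v _) -/(eval_at v _).
have := ratio_repr f; move: (generic_quotient.repr f) => r /= fE.
have d0 : \d_r != 0 by apply: denom_ratioP.
have : frac p * frac \d_r = frac \n_r * frac q.
  by apply/eqP; rewrite -eqr_div ?tofrac_eq0 // -fE.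
rewrite -!tofracM => /eqP; rewrite tofrac_eq => /eqP E.
by apply/eqP; rewrite eqr_div ?inj // -!rmorphM E.
Qed.

Lemma ratioP (f : K) : exists p, exists2 q, q != 0 & f = frac p / frac q.
Proof. by have := ratio_repr f; eexists; eexists; [|eassumption]; apply: denom_ratioP. Qed.

Lemma substitute_morphism v : (forall u, u != 0 -> eval_at v u != 0) ->
  exists2 phi : {rmorphism K -> K}, substitute v =1 phi & forall i, phi (zvar R i) = v i.
Proof.
move=> inj.
have sub_ratio p q : q != 0 -> substitute v (frac p / frac q) = eval_at v p / eval_at v q.
  exact: substitute_ratio.
have sub_frac p : substitute v (frac p) = eval_at v p.
  by rewrite -[frac p]divr1 -tofrac1 sub_ratio ?oner_eq0 // rmorph1 divr1.
have subB : zmod_morphism (substitute v).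
  move=> f g; have [p [q q0 ->]] := ratioP f; have [p' [q' q'0 ->]] := ratioP g.
  have -> : frac p / frac q - frac p' / frac q' = frac (p * q' - p' * q) / frac (q * q').
    by rewrite tofracB !tofracM -!mulNr addf_div ?tofrac_eq0 // mulNr.
  rewrite !sub_ratio ?mulf_neq0 // rmorphB !rmorphM /=.
  by rewrite -mulNr -[X in _ = _ + X]mulNr addf_div ?inj // mulNr.
have subM : monoid_morphism (substitute v).
  split; first by rewrite -tofrac1 sub_frac rmorph1.
  move=> f g; have [p [q q0 ->]] := ratioP f; have [p' [q' q'0 ->]] := ratioP g.
  have -> : (frac p / frac q) * (frac p' / frac q') = frac (p * p') / frac (q * q').
    by rewrite !tofracM mulf_div.
  rewrite !sub_ratio ?mulf_neq0 // !rmorphM /=.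
  by rewrite mulf_div.
pose subBm := GRing.isZmodMorphism.Build _ _ _ subB.
pose subMm := GRing.isMonoidMorphism.Build _ _ _ subM.
pose phi : {rmorphism K -> K} := HB.pack (substitute v) subBm subMm.
exists phi => // i; rewrite /= /zvar sub_frac /eval_at.
by rewrite mmapX mmap1U.
Qed.

Lemma eval_perm_neq0 (s : 'S_n) u : u != 0 -> eval_at (fun i => zvar R (s i)) u != 0.
Proof.
have -> : eval_at (fun i => zvar R (s i)) u = frac (msym s u).
  rewrite /eval_at /msym /mmap rmorph_sum /=; apply: eq_bigr => m _.
  rewrite rmorphM /=; congr (_ * _); rewrite /mmap1 rmorph_prod /=.
  by apply: eq_bigr => i _; rewrite rmorphXn.
rewrite tofrac_eq0; apply: contra_neq => su0.
by rewrite -[u]msym1m -(mulgV s) msymMm su0 raddf0.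
Qed.

Lemma zvar_neq0 i : zvar R i != 0 :> K.
Proof.
rewrite tofrac_eq0; apply/eqP => /(congr1 (mcoeff U_(i))).
by rewrite mcoeffX eqxx mcoeff0; apply/eqP; rewrite oner_eq0.
Qed.

(** Multiplying by a power of the inverted variable reverses the exponents of
    that variable, so distinct monomials stay distinct and the leading monomial
    of [u] survives. *)
Lemma eval_inv_neq0 (l : 'I_n) u : u != 0 ->
  eval_at (fun j => if j == l then (zvar R j)^-1 else zvar R j) u != 0.
Proof.
set v := fun j => _; move=> u0.
pose N := msize u.
pose flip (m : 'X_{1..n}) : 'X_{1..n} :=
  [multinom (if j == l then N - m j else m j)%N | j < n].
have flipE : eval_at v u * zvar R l ^+ N =
    frac (\sum_(m <- msupp u) u@_m *: 'X_[flip m]).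
  rewrite /eval_at /mmap mulr_suml rmorph_sum /=; apply: eq_big_seq => m um.
  rewrite -mul_mpolyC rmorphM /= -mulrA; congr (_ * _).
  rewrite mpolyXE_id rmorph_prod /= /mmap1 (bigD1 l) //= [RHS](bigD1 l) //=.
  rewrite mulrAC; congr (_ * _).
    rewrite rmorphXn /= mnmE /v eqxx exprVn -/(zvar R l).
    apply: (canLR (mulKf _)); first by rewrite expf_neq0 ?zvar_neq0.
    rewrite -exprD subnKC //; apply: leq_trans (ltnW (msize_mdeg_lt um)).
    by rewrite mdegE (bigD1 l) //= leq_addr.
  by apply: eq_bigr => j jl; rewrite rmorphXn /= mnmE /v (negPf jl).
suff : frac (\sum_(m <- msupp u) u@_m *: 'X_[flip m]) != 0.
  by rewrite -flipE mulf_eq0 negb_or => /andP[].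
rewrite tofrac_eq0; apply/eqP => /(congr1 (mcoeff (flip (mlead u)))).
rewrite mcoeff0 raddf_sum /= (bigD1_seq (mlead u)) ?mlead_supp ?msupp_uniq //=.
rewrite mcoeffZ mcoeffX eqxx mulr1 big_seq_cond big1 ?addr0.
  by apply/eqP; rewrite -mcoeff_msupp mlead_supp.
move=> m /andP[um ml]; rewrite mcoeffZ mcoeffX.
suff /negPf -> : flip m != flip (mlead u) by rewrite mulr0.
apply: contra ml => /eqP E; apply/eqP/mnmP => j.
have le_N w : w \in msupp u -> (w j <= N)%N.
  move=> uw; apply: leq_trans (ltnW (msize_mdeg_lt uw)).
  by rewrite mdegE (bigD1 j) //= leq_addr.
move/mnmP/(_ j): E; rewrite !mnmE; case: ifP => // _.
have := le_N _ um; have := le_N _ (mlead_supp u0); lia.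
Qed.

End Substitution.

(** * Reduced words of signed permutations *)

Section Weyl.
Variable n : nat.
Local Open Scope group_scope.
Local Notation letter := (signed n).
Implicit Types (x y : letter) (i j : 'I_n) (s : seq 'I_n) (u : {perm letter}).

Lemma barK : involutive (@bar n).
Proof. by case=> k b; rewrite /bar /= negbK. Qed.

Lemma bar_neq x : (bar x == x) = false.
Proof. by case: x => k b; rewrite xpair_eqE /= eqxx /= eqb_negLR; case: b. Qed.

Lemma color_gt_bar x y : color_gt (bar x) (bar y) = color_gt y x.
Proof. by case: x y => [i [|]] [j [|]]; rewrite /bar /= !color_gtE. Qed.

(** With [lower], the pair of neighbouring letters exchanged by the simple
    reflection; together with the barred pair in reverse order these are the
    only pairs that it inverts. *)
Definition upper i : letter := (i, false).
Definition lower i : letter := if (i.+1 < n)%N then (ordS i, false) else (i, true).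

(** The two transpositions coincide when [y] is the bar of [x], hence the case
    distinction. This form is stable under conjugation, unlike that of the
    simple reflections. *)
Definition reflection x y : {perm letter} :=
  if y == bar x then tperm x y else tperm x y * tperm (bar x) (bar y).

Lemma val_ordS i : (i.+1 < n)%N -> nat_of_ord (ordS i) = i.+1.
Proof. by move=> h; rewrite /= modn_small. Qed.

Lemma simple_reflectionE i : simple_reflection i = reflection (upper i) (lower i).
Proof.
rewrite /simple_reflection /reflection /upper /lower.
by case: ifP => h; rewrite /bar /= ?eqxx // xpair_eqE andbF.
Qed.

Lemma reflection_bar x y : x != y -> reflection (bar y) (bar x) = reflection x y.
Proof.
move=> xy; rewrite /reflection !barK [bar x == y]eq_sym.
case: eqVneq => [->|ny]; first by rewrite barK tpermC.
rewrite conjgC tpermJ !tpermD //.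
- by rewrite tpermC [tperm (bar y) _]tpermC.
- by rewrite eq_sym bar_neq.
- by rewrite eq_sym bar_neq.
- by apply: contraNneq ny => ->; rewrite barK.
Qed.

Lemma reflectionJ u x y : (forall z, u (bar z) = bar (u z)) ->
  reflection x y ^ u = reflection (u x) (u y).
Proof.
move=> ub; rewrite /reflection -ub (inj_eq perm_inj).
by case: ifP => _; rewrite ?conjMg !tpermJ ?ub.
Qed.

Lemma simple_reflection_val i k b : simple_reflection i (k, b) =
  if (i.+1 < n)%N then (tperm i (ordS i) k, b) else (k, (k == i) (+) b).
Proof.
rewrite /simple_reflection; case: ifP => hi; last first.
  rewrite permE /= !xpair_eqE; case: (k =P i) => [->|_] //=.
  by case: b.
rewrite permM; case: b; rewrite !permE /= !xpair_eqE /= ?andbF ?andbT /=.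
  by rewrite !xpair_eqE !andbT; case: (k == i); case: (k == ordS i).
by case: (k == i); [|case: (k == ordS i)]; rewrite !xpair_eqE !andbF.
Qed.

Lemma simple_reflection_bar i x : simple_reflection i (bar x) = bar (simple_reflection i x).
Proof.
case: x => k b; rewrite /bar /= !simple_reflection_val; case: ifP => //= _.
by rewrite addbN.
Qed.

Lemma simple_reflection_sq i : simple_reflection i * simple_reflection i = 1.
Proof.
apply/permP => -[k b]; rewrite permM perm1 simple_reflection_val.
by case: ifP => hi; rewrite simple_reflection_val hi ?tpermK // addbA addbb.
Qed.

Lemma simple_reflectionV i : (simple_reflection i)^-1 = simple_reflection i.
Proof. by apply/eqP; rewrite eq_invg_mul simple_reflection_sq. Qed.

Lemma word_perm_cat s1 s2 : word_perm (s1 ++ s2) = word_perm s2 * word_perm s1.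
Proof. by elim: s1 => [|i s1 IH] /=; rewrite ?mulg1 // IH mulgA. Qed.

Lemma word_perm_bar s x : word_perm s (bar x) = bar (word_perm s x).
Proof.
elim: s => [|i s IH] /=; first by rewrite !perm1.
by rewrite !permM IH simple_reflection_bar.
Qed.

Lemma word_permV_bar s x : (word_perm s)^-1 (bar x) = bar ((word_perm s)^-1 x).
Proof. by apply: (@perm_inj _ (word_perm s)); rewrite permKV word_perm_bar permKV. Qed.

(** The letters are compared as colours, so that 1, ..., n, bar n, ..., bar 1
    is decreasing. *)
Lemma simple_reflection_inversion j x y : color_gt x y ->
  ~~ color_gt (simple_reflection j x) (simple_reflection j y) ->
  (x, y) = (upper j, lower j) \/ (x, y) = (bar (lower j), bar (upper j)).
Proof.
case: x y => [k b] [l c]; rewrite !simple_reflection_val /upper /lower.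
case: ifP => hj.
  have ltS := val_ordS hj; rewrite !color_gtE.
  have neq_nat (p q : 'I_n) : p <> q -> nat_of_ord p <> q by move=> pq /val_inj.
  case: b; case: c => //= kl.
    case: tpermP => [?|?|/neq_nat ? /neq_nat ?];
      case: tpermP => [?|?|/neq_nat ? /neq_nat ?]; subst => nkl;
      first [by right | by exfalso; lia].
  case: tpermP => [?|?|/neq_nat ? /neq_nat ?];
    case: tpermP => [?|?|/neq_nat ? /neq_nat ?]; subst => nkl;
    first [by left | by exfalso; lia].
have le_last (p : 'I_n) : (p <= j)%N by have := ltn_ord p; lia.
rewrite !color_gtE; have := le_last k; have := le_last l => lj kj.
case: (k =P j) => [?|nkj]; case: (l =P j) => [?|nlj]; subst;
  case: b; case: c => //= h; rewrite ?h ?ltnn //; try by left.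
all: rewrite ?ltn_neqAle ?lj ?kj ?andbT.
all: try by case/negP; apply/eqP => /val_inj.
all: by exfalso; lia.
Qed.

(** Apply the letters of the word one after the other to an ordered pair that
    ends up reversed: some letter is the first to reverse it. *)
Lemma inversion_letter s x y : color_gt x y ->
  ~~ color_gt ((word_perm s)^-1 x) ((word_perm s)^-1 y) ->
  exists s1 j s2, s = s1 ++ j :: s2 /\
    ((x, y) = (word_perm s1 (upper j), word_perm s1 (lower j)) \/
     (x, y) = (word_perm s1 (bar (lower j)), word_perm s1 (bar (upper j)))).
Proof.
elim: s x y => [|j s IH] x y xy /=.
  by rewrite invg1 !perm1 xy.
rewrite invMg simple_reflectionV !permM => nxy.
have [gt|ngt] := boolP (color_gt (simple_reflection j x) (simple_reflection j y)).
  have [s1 [k [s2 [-> E]]]] := IH _ _ gt nxy.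
  exists (j :: s1), k, s2; split => //=.
  have sK z : simple_reflection j (simple_reflection j z) = z.
    by rewrite -permM simple_reflection_sq perm1.
  by case: E => -[E1 E2]; [left|right]; rewrite !permM -E1 -E2 !sK.
exists [::], j, s; split => //=; rewrite !perm1.
exact: simple_reflection_inversion.
Qed.

Lemma reduced_tail i s w : reduced_word (i :: s) w -> reduced_word s (word_perm s).
Proof.
move=> [wE red]; split=> // s' s'E.
by have /= := red (i :: s'); rewrite s'E => /(_ wE).
Qed.

Lemma upper_gt_lower i : color_gt (upper i) (lower i).
Proof.
rewrite /upper /lower; case: ifP => h; last by rewrite color_gtE.
have := val_ordS h; rewrite color_gtE /= => ->; exact: ltnSn.
Qed.

(** Exchange argument. Otherwise some letter [j] of [s] first reverses the pair
    exchanged by [i]; the two reflections are then conjugate by the prefix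
    before [j], so erasing [j] from [s] gives a word for the same permutation
    as [i :: s], shorter by two. *)
Lemma reduced_ascent i s w : reduced_word (i :: s) w ->
  color_gt ((word_perm s)^-1 (upper i)) ((word_perm s)^-1 (lower i)).
Proof.
move=> [wE red]; apply: contraT => ninv.
have [s1 [j [s2 [sE xyE]]]] := inversion_letter (upper_gt_lower i) ninv.
have neq : upper j != lower j.
  by apply: contraTneq (upper_gt_lower j) => <-; rewrite color_gtxx.
have conj : simple_reflection j ^ word_perm s1 = simple_reflection i.
  rewrite !simple_reflectionE; case: xyE => -[-> ->].
    by rewrite reflectionJ //; apply: word_perm_bar.
  by rewrite -[reflection (upper j) _]reflection_bar // reflectionJ //; apply: word_perm_bar.
have := red (s1 ++ s2).
rewrite -wE /= sE !word_perm_cat /= -conj conjgE.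
have -> : word_perm s2 * simple_reflection j * word_perm s1 *
    ((word_perm s1)^-1 * (simple_reflection j * word_perm s1)) = word_perm s2 * word_perm s1.
  by rewrite !mulgA mulgK -(mulgA (word_perm s2)) simple_reflection_sq mulg1.
by move=> /(_ erefl); rewrite !size_cat /=; lia.
Qed.

End Weyl.

(** * The partition function as a matrix entry *)

Section PathSums.
Variable F : fieldType.

(** A path of vertices with one more vertex at its end; paths are ordinal-
    indexed families, summed by peeling off their last member. *)
Definition ffun_rcons (T : finType) k (h : {ffun 'I_k.+1 -> T}) (x : T) :
    {ffun 'I_k.+2 -> T} :=
  [ffun i => if i == ord_max then x else h (inord i)].

Lemma ffun_rcons_max (T : finType) k (h : {ffun 'I_k.+1 -> T}) x :
  ffun_rcons h x ord_max = x.
Proof. by rewrite ffunE eqxx. Qed.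

Lemma ffun_rcons_inord (T : finType) k (h : {ffun 'I_k.+1 -> T}) x (j : nat) :
  (j <= k)%N -> ffun_rcons h x (inord j) = h (inord j).
Proof.
move=> jk; rewrite ffunE -val_eqE /= inordK; last by rewrite ltnS leqW.
by rewrite ltn_eqF.
Qed.

Lemma ord0_inord k : ord0 = inord 0 :> 'I_k.+1.
Proof. by apply: val_inj; rewrite /= inordK. Qed.

Lemma ord_max_inord k : ord_max = inord k :> 'I_k.+1.
Proof. by apply: val_inj; rewrite /= inordK. Qed.

Lemma sum_ffun_rcons (T : finType) k (G : {ffun 'I_k.+2 -> T} -> F) :
  \sum_h G h = \sum_x \sum_(h : {ffun 'I_k.+1 -> T}) G (ffun_rcons h x).
Proof.
rewrite pair_bigA /=.
rewrite (reindex (fun p : T * {ffun 'I_k.+1 -> T} => ffun_rcons p.2 p.1)) //=.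
exists (fun h => (h ord_max, [ffun i : 'I_k.+1 => h (inord i)])) => [[x h] _ | h _] /=.
  rewrite ffun_rcons_max; congr pair; apply/ffunP => i; rewrite ffunE.
  by rewrite ffun_rcons_inord ?inord_val // -ltnS.
apply/ffunP => i; rewrite !ffunE; case: eqP => [->|/eqP ni] //.
have lti : (i < k.+1)%N.
  by rewrite ltn_neqAle -ltnS ltn_ord andbT; apply: contra ni => /eqP E; apply/eqP/val_inj.
by rewrite inordK // inord_val.
Qed.

Lemma sum_ffun1 (T : finType) (G : {ffun 'I_1 -> T} -> F) :
  \sum_h G h = \sum_x G [ffun => x].
Proof.
rewrite (reindex (fun x : T => [ffun => x] : {ffun 'I_1 -> T})) //=.
exists (fun h : {ffun 'I_1 -> T} => h ord0) => [x _ | h _]; first by rewrite ffunE.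
by apply/ffunP => i; rewrite ffunE [i]ord1.
Qed.

(** Columns are numbered from right to left, whereas [ts] and [bs] list the
    spins from left to right. *)
Lemma sum_path_line n (A : vertex F n) m (ts bs : seq (spin n)) l (k : spin n -> F) :
  size ts = m -> size bs = m ->
  \sum_(h : {ffun 'I_m.+1 -> spin n} | h ord_max == l)
    (\prod_(j < m) A (h (inord j.+1)) (nth None ts (m - j.+1))
                     (h (inord j)) (nth None bs (m - j.+1))) * k (h ord0) =
  \sum_r line A l ts bs r * k r.
Proof.
move=> szt szb; elim: m ts bs szt szb l => [|m IH] [|t ts] [|b bs] //= => [_ _|[szt] [szb]] l.
  rewrite big_mkcond sum_ffun1; apply: eq_bigr => x _.
  by rewrite !ffunE big_ord0 eq_sym mul1r; case: eqP; rewrite ?mul1r ?mul0r.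
rewrite big_mkcond sum_ffun_rcons (bigD1 l) //= [X in _ + X]big1 ?addr0; last first.
  by move=> x /negPf xl; rewrite big1 // => h _; rewrite ffun_rcons_max xl.
transitivity (\sum_x A l t x b * \sum_r line A x ts bs r * k r); last first.
  under [LHS]eq_bigr => x _ do rewrite mulr_sumr.
  rewrite exchange_big /=; apply: eq_bigr => r _.
  by rewrite mulr_suml; apply: eq_bigr => x _; rewrite mulrA.
under [RHS]eq_bigr => x _ do rewrite -IH // mulr_sumr.
rewrite (partition_big (fun h : {ffun 'I_m.+1 -> spin n} => h ord_max) predT) //=.
apply: eq_bigr => x _; apply: eq_bigr => h /eqP hx.
rewrite ffun_rcons_max eqxx big_ord_recr /= subnn /=.
rewrite -!ord_max_inord ffun_rcons_max ffun_rcons_inord //.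
rewrite -ord_max_inord hx !ord0_inord ffun_rcons_inord // [X in X * _ = _]mulrC -mulrA.
congr (_ * (_ * _)); apply: eq_bigr => j _.
have jm := ltn_ord j.
by rewrite !ffun_rcons_inord ?(ltnW jm) // subSS -(subnSK jm).
Qed.

(** The vertical edges of a state form a path of 2k+1 levels, which is summed
    two levels at a time, one row pair per step. *)
Lemma sum_path_mx (T : finType) (p : nat -> T -> T -> T -> F) k (a c : T) :
  \sum_(W : {ffun 'I_k.*2.+1 -> T} | (W ord0 == a) && (W ord_max == c))
    \prod_(i < k) p i (W (inord i.*2)) (W (inord i.*2.+1)) (W (inord i.*2.+2)) =
  (\prod_(i < k) (\matrix_(x, y)
     \sum_mu p i (enum_val x) mu (enum_val y)) : 'M[F]_#|T|)%R (enum_rank a) (enum_rank c).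
Proof.
elim: k c => [|k IH] c.
  rewrite big_mkcond sum_ffun1 big_ord0 mxE (inj_eq enum_rank_inj).
  rewrite (bigD1 a) //= [X in _ + X]big1 ?addr0.
    by rewrite !ffunE eqxx big_ord0; case: eqP.
  by move=> x /negPf xa; rewrite ffunE xa.
rewrite [in RHS]big_ord_recr /= -mulmxE mxE.
rewrite big_mkcond doubleS sum_ffun_rcons (bigD1 c) //= [X in _ + X]big1 ?addr0; last first.
  by move=> x /negPf xc; rewrite big1 // => W _; rewrite ffun_rcons_max xc andbF.
rewrite sum_ffun_rcons /=.
transitivity (\sum_(b : T) (\sum_(W : {ffun 'I_k.*2.+1 -> T} | (W ord0 == a) && (W ord_max == b))
    \prod_(i < k) p i (W (inord i.*2)) (W (inord i.*2.+1)) (W (inord i.*2.+2)))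
      * \sum_mu p k b mu c).
  under [RHS]eq_bigr => b _ do rewrite mulr_sumr.
  rewrite [RHS]exchange_big /=; apply: eq_bigr => mu _.
  under [RHS]eq_bigr => b _ do rewrite mulr_suml.
  rewrite (partition_big (fun W : {ffun 'I_k.*2.+1 -> T} => W ord_max) predT) //=.
  apply: eq_bigr => b _; rewrite big_mkcondl [RHS]big_mkcond /=.
  rewrite [LHS]big_mkcond; apply: eq_bigr => W _.
  rewrite !ord0_inord !ffun_rcons_inord // ffun_rcons_max eqxx andbT.
  case: (W (inord 0) == a) => //=; case: eqP => // Wb.
  rewrite big_ord_recr /= -ord_max_inord; congr (_ * _).
    apply: eq_bigr => i _; have ik := ltn_ord i.
    by rewrite !ffun_rcons_inord //; lia.
  rewrite ffun_rcons_max (@ffun_rcons_inord _ _ _ c k.*2) ?leqnSn //.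
  rewrite (@ffun_rcons_inord _ _ _ c k.*2.+1) // -ord_max_inord ffun_rcons_max.
  by rewrite ffun_rcons_inord // -ord_max_inord Wb.
rewrite [RHS](reindex_omap enum_rank (fun x => Some (enum_val x))) /=; last first.
  by move=> x _; rewrite enum_valK.
apply: eq_big => [b|b _]; first by rewrite enum_rankK eqxx.
by rewrite IH mxE !enum_rankK mulmxE.
Qed.

(** For fixed vertical edges the weight of a state factors over the row pairs.
    *)
Lemma sum_ffun_prod (I J : finType) (T : finType)
    (G : I -> {ffun J -> T} -> {ffun J -> T} -> F) :
  \sum_(H : {ffun I * bool * J -> T})
     \prod_i G i [ffun j => H (i, false, j)] [ffun j => H (i, true, j)] =
  \prod_i \sum_x \sum_y G i x y.
Proof.
under [RHS]eq_bigr => i _ do rewrite pair_bigA /=.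
rewrite bigA_distr_bigA /=.
rewrite (reindex (fun f : {ffun I -> {ffun J -> T} * {ffun J -> T}} =>
  [ffun q : I * bool * J => if q.1.2 then (f q.1.1).2 q.2 else (f q.1.1).1 q.2])) /=.
  apply: eq_bigr => f _; apply: eq_bigr => i _.
  by congr G; apply/ffunP => j; rewrite !ffunE.
exists (fun H : {ffun I * bool * J -> T} =>
  [ffun i => ([ffun j => H (i, false, j)], [ffun j => H (i, true, j)])]) => [f _ | H _].
  by apply/ffunP => i; rewrite ffunE [RHS]surjective_pairing; congr pair;
    apply/ffunP => j; rewrite !ffunE.
by apply/ffunP => -[[i [|]] j]; rewrite ffunE /= ffunE /= ffunE.
Qed.

Lemma sum_ffun_rows (I T : finType) m (G : {ffun I * 'I_m -> T} -> F) :
  \sum_V G V = \sum_(W : {ffun I -> m.-tuple T})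
    G [ffun q => tnth (W q.1) (rev_ord q.2)].
Proof.
rewrite (reindex (fun W : {ffun I -> m.-tuple T} =>
  [ffun q : I * 'I_m => tnth (W q.1) (rev_ord q.2)])) //=.
exists (fun V : {ffun I * 'I_m -> T} =>
  [ffun i => [tuple V (i, rev_ord j) | j < m]]) => [W _ | V _].
  apply/ffunP => i; apply: eq_from_tnth => j.
  by rewrite ffunE tnth_mktuple ffunE rev_ordK.
by apply/ffunP => -[i j]; rewrite !ffunE tnth_mktuple rev_ordK.
Qed.
End PathSums.

Section Weights.
Variables (F : fieldType) (n : nat).
Local Notation S := (spin n).

(** The table of vertex weights, recovered from the outcomes. *)
Lemma gamma_vertexE (z : F) (l t r b : S) :
  gamma_vertex z l t r b =
  match l, t, r, b with
  | None, None, None, None => 1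
  | Some cl, Some ct, Some cr, Some cb =>
      if [|| [&& cl == cb, ct == cr & color_gt ct cl],
             [&& cl == cr, ct == cb & color_gt cl ct]
           | [&& cl == ct, ct == cr & cr == cb]] then z else 0
  | Some cl, None, Some cr, None => if cl == cr then z else 0
  | None, Some ct, Some cr, None => if ct == cr then 1 else 0
  | Some cl, None, None, Some cb => if cl == cb then z else 0
  | _, _, _, _ => 0
  end.
Proof.
rewrite /gamma_vertex /entry.
case: l => [l|]; case: t => [t|]; case: r => [r|]; case: b => [b|] /=;
  rewrite ?(inj_eq Some_inj) /=.
all: try by ring.
all: try by case: eqP => _ /=; ring.
all: case: (color_compare l t) => [[E1 E2]|E|[E1 E2]]; rewrite ?E ?color_gtxx ?E1 ?E2 /=.
all: rewrite ?(inj_eq Some_inj) ?andbT ?andbF ?eqxx /=.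
all: try by ring.
- have -> : (l == t) = false by apply/eqP => lt; rewrite lt color_gtxx in E1.
  by case: (l == r); case: (t == b) => /=; ring.
- by case: (t =P r) => [<-|_]; case: (t == b) => /=; ring.
- have -> : (l == t) = false by apply/eqP => lt; rewrite lt color_gtxx in E1 E2.
  by case: (t == r); case: (l == b) => /=; ring.
Qed.

Lemma delta_vertexE (z : F) (l t r b : S) :
  delta_vertex z l t r b =
  match l, t, r, b with
  | None, None, None, None => z
  | Some cl, Some ct, Some cr, Some cb =>
      if [|| [&& cl == ct, cr == cb & color_gt cr cl],
             [&& cl == cr, ct == cb & color_gt ct cl]
           | [&& cl == ct, ct == cr & cr == cb]] then 1 else 0
  | Some cl, None, Some cr, None => if cl == cr then 1 else 0
  | Some cl, Some ct, None, None => if cl == ct then 1 else 0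
  | None, None, Some cr, Some cb => if cr == cb then z else 0
  | _, _, _, _ => 0
  end.
Proof.
rewrite /delta_vertex /entry.
case: l => [l|]; case: t => [t|]; case: r => [r|]; case: b => [b|] /=;
  rewrite ?(inj_eq Some_inj) /=.
all: try by ring.
all: try by rewrite [l == _]eq_sym; case: eqP => _ /=; ring.
all: try by case: eqP => _ /=; ring.
all: case: (color_compare r t) => [[E1 E2]|E|[E1 E2]]; rewrite ?E ?color_gtxx ?E1 ?E2 /=.
all: rewrite ?(inj_eq Some_inj) ?andbT ?andbF ?eqxx /=.
all: try by ring.
- have tr : (t == r) = false by apply/eqP => tr; rewrite tr color_gtxx in E1.
  rewrite tr andbF orbF [t == l]eq_sym; case: (l =P t) => [->|_] /=.
    by rewrite tr E1 andbT orbF; case: (r == b) => /=; ring.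
  by case: (l =P r) => [->|_] /=; rewrite ?E2 ?andbF; ring.
- rewrite [t == l]eq_sym; case: (l =P t) => [->|_] /=; last by ring.
  by rewrite color_gtxx andbF; case: (t == b) => /=; ring.
- have tr : (t == r) = false by apply/eqP => tr; rewrite tr color_gtxx in E2.
  rewrite tr andbF orbF [r == l]eq_sym; case: (l =P r) => [->|_] /=.
    by rewrite [r == t]eq_sym tr E2 andbT; case: (t == b) => /=; ring.
  by rewrite orbF; case: (l =P t) => [->|_] /=; rewrite ?E1 ?andbF; ring.
Qed.

Lemma pair_mx_entry m (k z : F) (a : color n) i j :
  pair_mx m k z a i j = \sum_(mu : m.-tuple S) \sum_y uturn_value k y *
    (line (gamma_vertex z) None (spins_of i) mu y *
     line (delta_vertex z^-1) (Some a) mu (spins_of j) (uturn_out y)).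
Proof.
rewrite /pair_mx summxE exchange_big /=; apply: eq_bigr => y _.
by rewrite mxE line_mxM /lines mulr_sumr.
Qed.
End Weights.

Definition uturn_empty (F : fieldType) (q z : F) : F := z ^- 2 + q / z.

Definition model_mx (F : fieldType) n m (q : F) (v : 'I_n -> F)
    (a : 'I_n -> color n) : 'M[F]_#|{: m.-tuple (spin n)}| :=
  \prod_(i < n) pair_mx m (uturn_empty q (v i)) (v i) (a i).

(** The constant [q] for which the weight of the empty U-turn is z^-2 + q/z. *)
Definition turn_constant (F : fieldType) (X : cartan_type) : F :=
  if X is TypeB then 1 else 0.

Section PartitionFunction.
Variables (R : idomainType) (n : nat).
Local Notation K := (ratfun R n).
Local Notation S := (spin n).

Local Notation turn X := (turn_constant K X).

Lemma uturn_weightE X (z : K) (t b : S) :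
  uturn_weight X z t b = uturn_value (uturn_empty (turn X) z) t * (uturn_out t == b)%:R.
Proof.
rewrite /uturn_empty /turn_constant.
case: t b => [[i ti]|] [[j bj]|] /=; rewrite ?mulr0 ?mulr1 //; last first.
  by case: X; rewrite ?mul1r ?mul0r ?addr0.
rewrite mul1r (inj_eq Some_inj).
rewrite -[RHS](_ : (if down (i, ti) == (j, bj) then 1 else 0) = _); last by case: eqP.
congr (if _ then 1 else 0); apply/existsP/eqP => [[u /andP[/andP[nu /eqP ->]]]|[<- <-]].
  by case: u nu => k [] // _; rewrite !xpair_eqE /= => /orP[] /andP[/eqP -> _].
by exists (i, false); rewrite /bar /= eqxx /=; case: ti; rewrite eqxx ?orbT.
Qed.

Definition top_tuple m (lambda : 'I_n -> nat) : m.-tuple S :=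
  [tuple top_boundary lambda (rev_ord j) | j < m].

Definition exit_color (w : {perm signed n}) (i : 'I_n) : color n :=
  bar ((w^-1)%g (i, false)).

Lemma row_pair_sum X m (z : K) a (ts mus bs : m.-tuple S) :
  \sum_(x : {ffun 'I_m.+1 -> S} | x ord_max == None)
  \sum_(y : {ffun 'I_m.+1 -> S} | y ord_max == Some a)
    (\prod_(j < m) gamma_weight z (x (inord j.+1)) (tnth ts (rev_ord j))
        (x (inord j)) (tnth mus (rev_ord j))) *
    (\prod_(j < m) delta_weight z^-1 (y (inord j.+1)) (tnth mus (rev_ord j))
        (y (inord j)) (tnth bs (rev_ord j))) *
    uturn_weight X z (x ord0) (y ord0) =
  \sum_y uturn_value (uturn_empty (turn X) z) y *
    (line (gamma_vertex z) None ts mus y *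
     line (delta_vertex z^-1) (Some a) mus bs (uturn_out y)).
Proof.
have gE x ts' mus' : \prod_(j < m) gamma_weight z (x (inord j.+1)) (tnth ts' (rev_ord j))
      (x (inord j)) (tnth mus' (rev_ord j)) =
    \prod_(j < m) gamma_vertex z (x (inord j.+1)) (nth None ts' (m - j.+1))
      (x (inord j)) (nth None mus' (m - j.+1)) :> K.
  by apply: eq_bigr => j _; rewrite !(tnth_nth None) gamma_vertexE.
have dE x ts' mus' : \prod_(j < m) delta_weight z^-1 (x (inord j.+1)) (tnth ts' (rev_ord j))
      (x (inord j)) (tnth mus' (rev_ord j)) =
    \prod_(j < m) delta_vertex z^-1 (x (inord j.+1)) (nth None ts' (m - j.+1))
      (x (inord j)) (nth None mus' (m - j.+1)) :> K.
  by apply: eq_bigr => j _; rewrite !(tnth_nth None) delta_vertexE.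
transitivity (\sum_(x : {ffun 'I_m.+1 -> S} | x ord_max == None)
   (\prod_(j < m) gamma_vertex z (x (inord j.+1)) (nth None ts (m - j.+1))
        (x (inord j)) (nth None mus (m - j.+1))) *
   (uturn_value (uturn_empty (turn X) z) (x ord0) *
     line (delta_vertex z^-1) (Some a) mus bs (uturn_out (x ord0)))).
  apply: eq_bigr => x _; under eq_bigr => y _ do rewrite gE dE -mulrA.
  rewrite -mulr_sumr; congr (_ * _).
  rewrite (sum_path_line _ _ (uturn_weight X z (x ord0))) ?size_tuple //.
  rewrite (bigD1 (uturn_out (x ord0))) //= [X in _ + X]big1 ?addr0.
    by rewrite uturn_weightE eqxx mulr1 mulrC.
  by move=> r /negPf rx; rewrite uturn_weightE eq_sym rx !mulr0.
rewrite (sum_path_line _ _ (fun y => uturn_value (uturn_empty (turn X) z) y *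
     line (delta_vertex z^-1) (Some a) mus bs (uturn_out y))) ?size_tuple //.
by apply: eq_bigr => y _; rewrite mulrCA.
Qed.

Definition pair_weight X m (zs : 'I_n -> K) (a : 'I_n -> color n) (i : 'I_n)
    (ts mus bs : m.-tuple S) : K :=
  \sum_y uturn_value (uturn_empty (turn X) (zs i)) y *
    (line (gamma_vertex (zs i)) None ts mus y *
     line (delta_vertex (zs i)^-1) (Some (a i)) mus bs (uturn_out y)).

Lemma partition_functionE X m lambda w :
  partition_function R X m lambda w =
  model_mx m (turn X) (@zvar R n) (exit_color w) (enum_rank (top_tuple m lambda))
    (enum_rank [tuple of nseq m None]).
Proof.
pose p k := if insub k : option 'I_n is Some i
  then @pair_weight X m (@zvar R n) (exit_color w) i else fun _ _ _ => 0.
have -> : model_mx m (turn X) (@zvar R n) (exit_color w) =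
    \prod_(i < n) \matrix_(x, y) \sum_mu p i (enum_val x) mu (enum_val y).
  apply: eq_bigr => i _; apply/matrixP => x y; rewrite mxE pair_mx_entry.
  by apply: eq_bigr => mu _; rewrite /p valK.
rewrite -sum_path_mx /partition_function big_mkcond.
rewrite -(pair_bigA _ (fun (H : {ffun hedge n m -> S}) (V : {ffun vedge n m -> S}) =>
  if is_state lambda w (H, V) then state_weight R X (H, V) else 0)) /=.
rewrite exchange_big /= sum_ffun_rows [RHS]big_mkcond /=.
apply: eq_bigr => W _; rewrite /is_state /=.
have forall_tnth (u v : m.-tuple S) :
    [forall j, tnth u (rev_ord j) == tnth v (rev_ord j)] = (u == v).
  apply/forallP/eqP => [uv|-> //]; apply: eq_from_tnth => j.
  by rewrite -(rev_ordK j); apply/eqP.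
have -> : [forall j : 'I_m, [ffun q : vedge n m => tnth (W q.1) (rev_ord q.2)] (ord0, j)
    == top_boundary lambda j] = (W ord0 == top_tuple m lambda).
  by rewrite -forall_tnth; apply: eq_forallb => j; rewrite ffunE tnth_mktuple rev_ordK.
have -> : [forall j : 'I_m, [ffun q : vedge n m => tnth (W q.1) (rev_ord q.2)] (ord_max, j)
    == None] = (W ord_max == [tuple of nseq m None]).
  by rewrite -forall_tnth; apply: eq_forallb => j; rewrite ffunE tnth_nseq.
case: (W ord0 == _); case: (W ord_max == _) => /=; try by rewrite big1.
pose G i (x y : {ffun 'I_m.+1 -> S}) : K :=
  if (x ord_max == None) && (y ord_max == Some (exit_color w i)) then
    (\prod_(j < m) gamma_weight (zvar R i) (x (inord j.+1))
        (tnth (W (inord i.*2)) (rev_ord j))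
        (x (inord j)) (tnth (W (inord i.*2.+1)) (rev_ord j))) *
    (\prod_(j < m) delta_weight (zvar R i)^-1 (y (inord j.+1))
        (tnth (W (inord i.*2.+1)) (rev_ord j))
        (y (inord j)) (tnth (W (inord i.*2.+2)) (rev_ord j))) *
    uturn_weight X (zvar R i) (x ord0) (y ord0)
  else 0.
transitivity (\sum_(H : {ffun hedge n m -> S})
    \prod_i G i [ffun j => H (i, false, j)] [ffun j => H (i, true, j)]).
  apply: eq_bigr => H _; case: ifP => [/forallP left | nleft].
    apply: eq_bigr => i _; rewrite /G !ffunE.
    have /forallP left_i := left i.
    rewrite (eqP (left_i false)) (eqP (left_i true)) /= !eqxx /=.
    rewrite big_bool /= mulrC [in RHS]mulrC; congr (_ * _); rewrite mulrC.
    congr (_ * _); apply: eq_bigr => j _; rewrite /vertex_weight /= !ffunE /=.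
      by rewrite addn0.
    by rewrite addn1.
  symmetry; apply/eqP; rewrite prodf_seq_eq0; apply/hasP.
  move/negbT: nleft; rewrite negb_forall => /existsP[i nli].
  exists i; first by rewrite mem_index_enum.
  rewrite /= /G !ffunE; case: ifP => // /andP[fl tr].
  case/negP: nli; apply/forallP => -[]; [exact: tr | exact: fl].
rewrite sum_ffun_prod; apply: eq_bigr => i _.
rewrite /p valK /pair_weight -row_pair_sum [RHS]big_mkcond /=.
apply: eq_bigr => x _; rewrite /G; case: (x ord_max == None) => /=.
  by rewrite [RHS]big_mkcond.
by rewrite big1.
Qed.
End PartitionFunction.

(** * Products of row pairs *)

Section Morphism.
Variables (F F' : fieldType) (phi : {rmorphism F -> F'}) (n : nat).
Local Notation S := (spin n).

Lemma line_morph (A : vertex F n) (A' : vertex F' n) :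
  (forall l t r b, phi (A l t r b) = A' l t r b) ->
  forall l ts bs r, phi (line A l ts bs r) = line A' l ts bs r.
Proof.
move=> AA' l ts; elim: ts l => [|t ts IH] l [|b bs] r /=; rewrite ?rmorph0 ?rmorph_nat //.
by rewrite rmorph_sum; apply: eq_bigr => x _; rewrite rmorphM AA' IH.
Qed.

Lemma gamma_vertex_morph z (l t r b : S) :
  phi (gamma_vertex z l t r b) = gamma_vertex (phi z) l t r b .
Proof.
rewrite !gamma_vertexE; case: l => [l|]; case: t => [t|]; case: r => [r|]; case: b => [b|];
  by rewrite /= ?(fun_if phi) ?rmorph0 ?rmorph1.
Qed.

Lemma delta_vertex_morph z (l t r b : S) :
  phi (delta_vertex z l t r b) = delta_vertex (phi z) l t r b .
Proof.
rewrite !delta_vertexE; case: l => [l|]; case: t => [t|]; case: r => [r|]; case: b => [b|];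
  by rewrite /= ?(fun_if phi) ?rmorph0 ?rmorph1.
Qed.

Lemma pair_mx_morph m k z a :
  map_mx phi (@pair_mx F n m k z a) = pair_mx m (phi k) (phi z) a.
Proof.
apply/matrixP => i j; rewrite mxE !pair_mx_entry rmorph_sum; apply: eq_bigr => mu _.
rewrite rmorph_sum; apply: eq_bigr => y _; rewrite !rmorphM.
congr (_ * (_ * _)); first by case: y => [y|] /=; rewrite ?rmorph1.
  by apply: line_morph => *; apply: gamma_vertex_morph.
by apply: line_morph => *; rewrite delta_vertex_morph fmorphV.
Qed.

End Morphism.

Section Products.

Lemma extend_to_nat (T : Type) n (P : 'I_n -> T) (d : T) :
  exists Q : nat -> T, forall j : 'I_n, Q j = P j.
Proof. by exists (fun k => if insub k is Some j then P j else d) => j; rewrite valK. Qed.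

Variables (F : fieldType) (N : nat).
Implicit Types P Q : nat -> 'M[F]_N.

Lemma prod_swap_two n (i : 'I_n) (P P' P'' : 'I_n -> 'M[F]_N) (c c' c'' : F) :
  (i.+1 < n)%N ->
  (forall j, j != i -> j != ordS i -> P' j = P j /\ P'' j = P j) ->
  c' *: (P' i *m P' (ordS i)) = c *: (P i *m P (ordS i)) + c'' *: (P'' i *m P'' (ordS i)) ->
  c' *: \prod_j P' j = c *: \prod_j P j + c'' *: \prod_j P'' j.
Proof.
move=> hi agree loc.
have split_prod (Q : 'I_n -> 'M[F]_N) : \prod_j Q j =
    (\prod_(j < n | (j < i)%N) Q j) *m (Q i *m Q (ordS i)) *m
    (\prod_(j < n | (i.+1 < j)%N) Q j).
  have [q qE] := extend_to_nat Q 1.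
  have -> : \prod_j Q j = \prod_(0 <= k < n) q k.
    by rewrite big_mkord; apply: eq_bigr => j _; rewrite qE.
  have -> : \prod_(j < n | (j < i)%N) Q j = \prod_(0 <= k < i) q k.
    by rewrite big_mkord (big_ord_widen n q (ltnW (ltn_ord i))); apply: eq_bigr => j _; rewrite qE.
  have -> : \prod_(j < n | (i.+1 < j)%N) Q j = \prod_(i.+2 <= k < n) q k.
    by rewrite (big_nat_widenl _ 0%N) // big_mkord; apply: eq_bigr => j _; rewrite qE.
  rewrite (@big_cat_nat _ _ _ i) //= ?(ltnW (ltn_ord i)) //.
  rewrite (@big_ltn _ _ _ i n) ?ltn_ord // (@big_ltn _ _ _ i.+1 n) //.
  rewrite -(qE i) -(qE (ordS i)) val_ordS //.
  by rewrite !mulmxE !mulrA.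
have before (Q : 'I_n -> 'M[F]_N) : (forall j, j != i -> j != ordS i -> Q j = P j) ->
    \prod_(j < n | (j < i)%N) Q j = \prod_(j < n | (j < i)%N) P j.
  move=> QP; apply: eq_bigr => j ji; apply: QP; rewrite -val_eqE /= ?modn_small //; lia.
have after (Q : 'I_n -> 'M[F]_N) : (forall j, j != i -> j != ordS i -> Q j = P j) ->
    \prod_(j < n | (i.+1 < j)%N) Q j = \prod_(j < n | (i.+1 < j)%N) P j.
  move=> QP; apply: eq_bigr => j ji; apply: QP; rewrite -val_eqE /= ?modn_small //; lia.
have P'P j : j != i -> j != ordS i -> P' j = P j by move=> h1 h2; case: (agree j h1 h2).
have P''P j : j != i -> j != ordS i -> P'' j = P j by move=> h1 h2; case: (agree j h1 h2).
rewrite !split_prod (before P') // (before P'') // (after P') // (after P'') //.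
have sc a (L M M' : 'M[F]_N) : a *: (L *m M *m M') = L *m (a *: M) *m M'.
  by rewrite -scalemxAr -scalemxAl.
by rewrite !sc -mulmxDl -mulmxDr loc.
Qed.

Lemma prod_last n (i : 'I_n) (P : 'I_n -> 'M[F]_N) : (i.+1 < n)%N = false ->
  \prod_j P j = (\prod_(j < n | (j < i)%N) P j) *m P i.
Proof.
move=> hi; have [q qE] := extend_to_nat P 1.
have nE : n = i.+1 by have := ltn_ord i; lia.
have -> : \prod_j P j = \prod_(0 <= k < n) q k.
  by rewrite big_mkord; apply: eq_bigr => j _; rewrite qE.
have -> : \prod_(j < n | (j < i)%N) P j = \prod_(0 <= k < i) q k.
  by rewrite big_mkord (big_ord_widen n q (ltnW (ltn_ord i))); apply: eq_bigr => j _; rewrite qE.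
by rewrite [X in \prod_(0 <= k < X) _]nE big_nat_recr //= qE.
Qed.

(** Each matrix sends one basis vector to a multiple of the next. *)
Lemma prod_chain n (P : 'I_n -> 'M[F]_N) (c : 'I_n -> F) (x : nat -> 'I_N) :
  (forall (k : 'I_n) y, P k (x k) y = (x k.+1 == y)%:R * c k) ->
  (\prod_k P k) (x 0%N) (x n) = \prod_k c k.
Proof.
move=> step; have [q qE] := extend_to_nat P 1; have [d dE] := extend_to_nat c 1.
have -> : \prod_k P k = \prod_(0 <= k < n) q k.
  by rewrite big_mkord; apply: eq_bigr => j _; rewrite qE.
have -> : \prod_k c k = \prod_(0 <= k < n) d k.
  by rewrite big_mkord; apply: eq_bigr => j _; rewrite dE.
have {}step k y : (k < n)%N -> q k (x k) y = (x k.+1 == y)%:R * d k.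
  by move=> kn; rewrite -[k]/(nat_of_ord (Ordinal kn)) qE dE step.
have [r rn] : exists r, (0 + r = n)%N by exists n.
move: 0%N rn => k; elim: r k => [|r IH] k rn.
  by move: rn; rewrite addn0 => <-; rewrite !big_geq // mxE eqxx.
have kn : (k < n)%N by lia.
rewrite big_ltn // [RHS]big_ltn // -mulmxE mxE (bigD1 (x k.+1)) //= [X in _ + X]big1 ?addr0.
  by rewrite step // eqxx mul1r IH //; lia.
by move=> y /negPf xy; rewrite step // eq_sym xy !mul0r.
Qed.
End Products.

Section Steps.
Variables (F : fieldType) (n m : nat) (q : F).
Local Notation model := (@model_mx F n m q).

Lemma model_morph (F' : fieldType) (phi : {rmorphism F -> F'}) (v : 'I_n -> F) v' a t b :
  (forall i, phi (v i) = v' i) ->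
  phi (model v a t b) = model_mx m (phi q) v' a t b.
Proof.
move=> vv'; suff <- : map_mx phi (model v a) = model_mx m (phi q) v' a by rewrite mxE.
rewrite /model_mx (big_morph (map_mx phi) (id1 := 1) (op1 := *%R)) /=.
- apply: eq_bigr => i _; rewrite pair_mx_morph vv'; congr (pair_mx _ _ _ _).
  by rewrite /uturn_empty rmorphD fmorphV rmorphXn fmorph_div /= vv'.
- by move=> A B; rewrite -!mulmxE map_mxM.
- exact: map_mx1.
Qed.

(** [pair_exchange], inserted into the product of all row pairs. *)
Lemma model_adjacent (i : 'I_n) v v' a a' t b : (i.+1 < n)%N ->
  v i != 0 -> v (ordS i) != 0 -> color_gt (a (ordS i)) (a i) ->
  (forall j, v' j = v (tperm i (ordS i) j)) -> (forall j, a' j = a (tperm i (ordS i) j)) ->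
  v i * model v' a t b = v (ordS i) * model v a t b + (v (ordS i) - v i) * model v a' t b.
Proof.
move=> hi vi vo gt v'E a'E.
suff : v i *: model v' a = v (ordS i) *: model v a + (v (ordS i) - v i) *: model v a'.
  by move/matrixP/(_ t b); rewrite !mxE.
apply: (prod_swap_two hi) => [j ji jo|].
  by rewrite v'E a'E tpermD // eq_sym.
by rewrite !v'E !a'E tpermL tpermR; apply: pair_exchange.
Qed.

(** [drain_reflect], multiplied by the product of the other row pairs, which
    does not involve the last variable. *)
Lemma model_last (i l : 'I_n) v v' a a' d d' t :
  let b := enum_rank [tuple of nseq m None] in
  (i.+1 < n)%N = false -> v i != 0 -> d != 0 -> d' != 0 ->
  uturn_empty q (v i) * d = 1 - v i ^- 2 ->
  uturn_empty q (v i)^-1 * d' = 1 - v i ^+ 2 -> d + d' + d * d' = 0 ->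
  (forall j, v' j = if j == i then (v j)^-1 else v j) ->
  a i = (l, true) -> (forall j, a' j = if j == i then (l, false) else a j) ->
  model v a' t b * d = model v a t b - model v' a t b.
Proof.
move=> b hi vi d0 d'0 kd kd' dd v'E ai a'E.
have eq_prefix (w : 'I_n -> F) (c : 'I_n -> color n) :
    (forall j, j != i -> w j = v j) -> (forall j, j != i -> c j = a j) ->
    model w c = (\prod_(j < n | (j < i)%N) pair_mx m (uturn_empty q (v j)) (v j) (a j))
      *m pair_mx m (uturn_empty q (w i)) (w i) (c i).
  move=> wv ca; rewrite /model_mx (prod_last _ hi); congr (_ *m _).
  apply: eq_bigr => j ji; have jni : j != i by rewrite -val_eqE /= ltn_eqF.
  by rewrite wv // ca.
rewrite (eq_prefix v a) // (eq_prefix v a') => [|//|j /negPf ji]; last by rewrite a'E ji.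
rewrite (eq_prefix v' a) => [|j /negPf ji|//]; last by rewrite v'E ji.
rewrite !mxE mulr_suml -sumrB; apply: eq_bigr => x _; rewrite -mulrA -mulrBr; congr (_ * _).
rewrite !pair_mxE /spins_of enum_rankK v'E a'E eqxx ai.
have := drain_reflect l (spins_of x) vi d0 d'0 kd kd' dd.
by rewrite size_tuple.
Qed.
End Steps.

(** * Demazure operators *)

(** Passage from the linear relation between Z', its reflection SZ' and Z to
    the Demazure operator; [r] stands for z^rho, whose reflection [Sr] is not
    [r]. *)
Lemma solve_adjacent (F : fieldType) (z1 z2 Z Z' SZ' r f Sr Sf : F) :
  z1 != 0 -> z2 != 0 -> z1 != z2 ->
  z1 * SZ' = z2 * Z' + (z2 - z1) * Z ->
  Z' = r * f -> SZ' = Sr * Sf -> z1 * Sr = z2 * r ->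
  Z = r * ((f - Sf) / (z1 * z2^-1 - 1)).
Proof.
move=> z10 z20 z12 E EZ ES Er.
have d0 : z1 - z2 != 0 by rewrite subr_eq0.
have -> : z1 * z2^-1 - 1 = (z1 - z2) / z2 by field.
have EZ1 : (z1 - z2) * Z = z2 * r * (f - Sf).
  have -> : (z1 - z2) * Z = z2 * Z' - z1 * SZ' by rewrite E; ring.
  by rewrite EZ ES (mulrA z1) Er; ring.
by rewrite -(mulKf d0 Z) EZ1; field; rewrite z20 d0.
Qed.

Lemma solve_last (F : fieldType) (d Z Z' SZ' r f Sf : F) :
  d != 0 -> Z * d = Z' - SZ' -> Z' = r * f -> SZ' = r * Sf ->
  Z = r * ((f - Sf) / d).
Proof. by move=> d0 E EZ ES; rewrite -(mulfK d0 Z) E EZ ES; field. Qed.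

Lemma swap_factors (F : fieldType) (a b c d e : F) :
  a * ((b * c) * (d * e)) = b * ((a * d) * (c * e)).
Proof. by ring. Qed.

(** The conditions under which the last row pair realizes the Demazure operator
    of either type. *)
Lemma reflect_constants (F : fieldType) (X : cartan_type) (z : F) (q := if X is TypeB then 1 else 0)
   (den := fun y : F => if X is TypeB then y - 1 else y ^+ 2 - 1) :
  z != 0 -> den z != 0 ->
  [/\ den z^-1 != 0, (z ^- 2 + q / z) * den z = 1 - z ^- 2,
      (z^-1 ^- 2 + q / z^-1) * den z^-1 = 1 - z ^+ 2
    & den z + den z^-1 + den z * den z^-1 = 0].
Proof.
move=> z0; rewrite /den /q => {q den}; case: X => dz; split; try by field.
- by rewrite subr_eq0 invr_eq1 -subr_eq0.
- by rewrite exprVn !invrK; field.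
- by rewrite exprVn subr_eq0 invr_eq1 -subr_eq0.
- by rewrite exprVn !invrK; field.
Qed.

Section Reflections.
Variables (R : idomainType) (n : nat).
Local Notation K := (ratfun R n).
Local Notation z := (@zvar R n).

Lemma ordS_neq (i : 'I_n) : (i.+1 < n)%N -> ordS i != i.
Proof. by move=> hi; apply/eqP => /(congr1 (@nat_of_ord n)); rewrite val_ordS //; lia. Qed.

Lemma zvar_neq (i j : 'I_n) : i != j -> z i != z j.
Proof.
apply: contra; rewrite tofrac_eq => /eqP/(congr1 (mcoeff U_(i)%MM)).
rewrite !mcoeffX eqxx eq_mnm1 [j == i]eq_sym; case: (i == j) => //= /eqP.
by rewrite oner_eq0.
Qed.

Lemma zvar_expr_neq1 (i : 'I_n) k : z i ^+ k.+1 != 1.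
Proof.
rewrite -rmorphXn -tofrac1 tofrac_eq; apply/eqP => /(congr1 (mcoeff 0%MM)).
rewrite mcoeffXn mcoeff1 eqxx; case: eqP => [/(congr1 mdeg)|_ /esym/eqP].
  by rewrite mdegMn mdeg1 mdeg0 mul1n.
by rewrite oner_eq0.
Qed.

Lemma demazure_denominator_neq0 X (i : 'I_n) : demazure_denominator R X i != 0.
Proof.
rewrite /demazure_denominator; case: ifP => hi.
  rewrite subr_eq0; apply/eqP => E.
  have io : i != ordS i by rewrite eq_sym ordS_neq.
  by case/eqP: (zvar_neq io); rewrite -[RHS]mul1r -E mulfVK // zvar_neq0.
by case: X; rewrite subr_eq0 -1?[z i]expr1 zvar_expr_neq1.
Qed.

Lemma zmonomial_nat (e : 'I_n -> nat) : zmonomial R (fun i => (e i)%:Z) = \prod_i z i ^+ e i.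
Proof. by []. Qed.

Lemma rho_adjacent (phi : {rmorphism K -> K}) (i : 'I_n) : (i.+1 < n)%N ->
  (forall j, phi (z j) = z (tperm i (ordS i) j)) ->
  z i * phi (zmonomial R (@rho n)) = z (ordS i) * zmonomial R (@rho n).
Proof.
move=> hi phiE; have oi := ordS_neq hi.
rewrite /rho zmonomial_nat rmorph_prod (bigD1 i) //= (bigD1 (ordS i)) //=.
rewrite [in RHS](bigD1 i) //= [in RHS](bigD1 (ordS i)) //= !rmorphXn !phiE.
rewrite tpermL tpermR (modn_small hi) -(subnSK hi) !exprS swap_factors; congr (_ * (_ * (_ * _))).
apply: eq_bigr => j /andP[ji jo]; rewrite rmorphXn phiE tpermD // eq_sym //.
Qed.

Lemma rho_last (phi : {rmorphism K -> K}) (i : 'I_n) : (i.+1 < n)%N = false ->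
  (forall j, phi (z j) = if j == i then (z j)^-1 else z j) ->
  phi (zmonomial R (@rho n)) = zmonomial R (@rho n).
Proof.
move=> hi phiE; rewrite /rho zmonomial_nat rmorph_prod; apply: eq_bigr => j _.
rewrite rmorphXn phiE; case: eqP => // ->.
have -> : (n - i.+1 = 0)%N by have := ltn_ord i; lia.
by rewrite !expr0.
Qed.

Lemma reflected_morphism (i : 'I_n) :
  exists2 phi : {rmorphism K -> K}, substitute (reflected_vars R i) =1 phi &
    forall j, phi (z j) = reflected_vars R i j.
Proof.
apply: substitute_morphism => u u0; rewrite /reflected_vars; case: ifP => hi.
  exact: eval_perm_neq0.
exact: eval_inv_neq0.
Qed.

Lemma turn_constant_morph (F F' : fieldType) (phi : {rmorphism F -> F'}) X :
  phi (turn_constant F X) = turn_constant F' X.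
Proof. by case: X; rewrite ?rmorph0 ?rmorph1. Qed.

Lemma exit_color_cons (i : 'I_n) s j :
  exit_color (word_perm (i :: s)) j =
  bar ((word_perm s)^-1%g (simple_reflection i (j, false))).
Proof. by rewrite /exit_color /= invMg simple_reflectionV permM. Qed.

(** The reducedness of the word provides the order of the exit colours that
    [model_adjacent] requires. *)
Lemma model_step_adjacent X m (i : 'I_n) s w t b (f : K) : (i.+1 < n)%N ->
  reduced_word (i :: s) w ->
  model_mx m (turn_constant K X) z (exit_color (word_perm s)) t b = zmonomial R (@rho n) * f ->
  model_mx m (turn_constant K X) z (exit_color w) t b = zmonomial R (@rho n) * demazure_op X i f.
Proof.
move=> hi red IH.
have ab := reduced_ascent red; case: red => <- _ {w}.
have [phi phiE phi_z] := reflected_morphism i.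
have {}phi_z j : phi (z j) = z (tperm i (ordS i) j) by rewrite phi_z /reflected_vars hi.
have oi := ordS_neq hi.
set a := exit_color (word_perm s).
have ab' : color_gt (a (ordS i)) (a i).
  by rewrite /a /exit_color color_gt_bar; move: ab; rewrite /upper /lower hi.
have aE j : exit_color (word_perm (i :: s)) j = a (tperm i (ordS i) j).
  by rewrite exit_color_cons simple_reflection_val hi.
rewrite /demazure_op phiE /demazure_denominator hi.
apply: (solve_adjacent (SZ' := phi (model_mx m (turn_constant K X) z a t b)) _ _ _ _ IH).
- exact: zvar_neq0.
- exact: zvar_neq0.
- by apply: zvar_neq; rewrite eq_sym.
- rewrite (@model_morph _ _ _ _ _ phi _ _ _ _ _ phi_z) turn_constant_morph.
  by apply: model_adjacent => //; apply: zvar_neq0.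
- by rewrite IH rmorphM.
- exact: rho_adjacent.
Qed.

(** The reducedness of the word provides that the last exit colour is barred,
    as [model_last] requires. *)
Lemma model_step_last X m (i : 'I_n) s w t (f : K) : (i.+1 < n)%N = false ->
  let b := enum_rank [tuple of nseq m None] in
  reduced_word (i :: s) w ->
  model_mx m (turn_constant K X) z (exit_color (word_perm s)) t b = zmonomial R (@rho n) * f ->
  model_mx m (turn_constant K X) z (exit_color w) t b = zmonomial R (@rho n) * demazure_op X i f.
Proof.
move=> hi b red IH.
have ab := reduced_ascent red; case: red => <- _ {w}.
have [phi phiE phi_z] := reflected_morphism i.
have {}phi_z j : phi (z j) = if j == i then (z j)^-1 else z j by rewrite phi_z /reflected_vars hi.
set a := exit_color (word_perm s).
have [l lE] : exists l, (word_perm s)^-1%g (i, false) = (l, false).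
  move: ab; rewrite /upper /lower hi.
  rewrite -[(i, true)]/(bar (i, false)) word_permV_bar.
  by case: (_ (i, false)) => l [|]; rewrite /bar /= color_gtE //; exists l.
have ai : a i = (l, true) by rewrite /a /exit_color lE.
have aE j : exit_color (word_perm (i :: s)) j = if j == i then (l, false) else a j.
  rewrite exit_color_cons simple_reflection_val hi addbF.
  by case: eqP => [->|//]; rewrite -[(i, true)]/(bar (i, false)) word_permV_bar lE.
have den0 := demazure_denominator_neq0 X i.
have denE : demazure_denominator R X i = if X is TypeB then z i - 1 else z i ^+ 2 - 1.
  by rewrite /demazure_denominator hi; clear; case: X.
have [dV0 kd kd' dd] := reflect_constants (zvar_neq0 R i) (eq_ind _ (fun y => y != 0) den0 _ denE).
rewrite /demazure_op phiE.
apply: (solve_last (SZ' := phi (model_mx m (turn_constant K X) z a t b)) den0 _ IH); last first.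
  by rewrite IH rmorphM (rho_last hi phi_z).
rewrite (@model_morph _ _ _ _ _ phi _ _ _ _ _ phi_z) turn_constant_morph denE.
rewrite denE in den0.
exact: (model_last t hi (zvar_neq0 R i) den0 dV0 kd kd' dd _ ai aE).
Qed.

End Reflections.

(** * The identity permutation and the theorem *)

Section Identity.
Variables (F : fieldType) (n m : nat) (q : F) (p : 'I_n -> nat).
Hypothesis position_decr : forall i j : 'I_n, (i < j)%N -> (p j < p i)%N.
Hypothesis position_lt : forall i, (p i < m)%N.
Local Notation S := (spin n).

(** The spins above row pair [k] in the unique state for the identity: the
    colours c_i with i >= k are still at their initial columns [p i]. *)
Definition remaining (k j : nat) : S :=
  if [pick i : 'I_n | (j == p i) && (k <= i)%N] is Some i then Some (i, false) else None.

Lemma position_inj (i j : 'I_n) : p i = p j -> i = j.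
Proof.
case: (ltngtP i j) => [ij|ij|/val_inj //] E.
  by have := position_decr ij; rewrite E ltnn.
by have := position_decr ij; rewrite E ltnn.
Qed.

Lemma remaining_Some k (i : 'I_n) : (k <= i)%N -> remaining k (p i) = Some (i, false).
Proof.
rewrite /remaining => ki; case: pickP => [j /andP[/eqP/position_inj -> //]|/(_ i)].
by rewrite eqxx ki.
Qed.

Lemma remaining_None k j : (forall i : 'I_n, (k <= i)%N -> j != p i) -> remaining k j = None.
Proof.
by rewrite /remaining => H; case: pickP => // i /andP[/eqP E /H]; rewrite E eqxx.
Qed.

Definition remaining_tuple k : m.-tuple S := [tuple remaining k (rev_ord j) | j < m].

Lemma remaining_seq k : tval (remaining_tuple k) = map (remaining k) (rev (iota 0 m)).
Proof.
apply: (@eq_from_nth _ None) => [|j]; rewrite size_tuple.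
  by rewrite size_map size_rev size_iota.
move=> jm; rewrite (nth_map 0%N) ?size_rev ?size_iota // nth_rev ?size_iota //.
rewrite nth_iota ?add0n; last by lia.
by rewrite -[j]/(nat_of_ord (Ordinal jm)) -tnth_nth tnth_mktuple.
Qed.

Lemma remaining_split (k : 'I_n) (k' : nat) : (k <= k')%N ->
  tval (remaining_tuple k') = nseq (m - (p k).+1) None ++
    remaining k' (p k) :: map (remaining k') (rev (iota 0 (p k))).
Proof.
move=> kk'; rewrite remaining_seq.
have {1}-> : m = (p k + (m - (p k).+1).+1)%N by have := position_lt k; lia.
rewrite iotaD rev_cat map_cat add0n /= rev_cons map_rcons cat_rcons; congr (_ ++ _).
set pre := map _ _; have -> : (m - (p k).+1)%N = size pre by rewrite size_map size_rev size_iota.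
apply/all_pred1P/allP => _ /mapP[j + ->].
rewrite mem_rev mem_iota => /andP[pj _] /=; rewrite remaining_None // => i ki.
apply: contraTneq pj => ->; rewrite -leqNgt.
have [->//|ik] := eqVneq i k; apply: ltnW (position_decr _).
by rewrite ltn_neqAle (leq_trans kk' ki) andbT eq_sym.
Qed.

(** With the bar of c_k as exit colour, row pair [k] removes the leftmost
    colour, c_k, and leaves the others in place. *)
Lemma pair_mx_identity (w z : F) (k : 'I_n) y :
  pair_mx m w z (k, true) (enum_rank (remaining_tuple k)) y =
  (enum_rank (remaining_tuple k.+1) == y)%:R * z ^+ p k.
Proof.
rewrite pair_mxE /spins_of enum_rankK (remaining_split (leqnn k)) remaining_Some //.
have -> : (enum_rank (remaining_tuple k.+1) == y) =
    (remaining_tuple k.+1 == spins_of y).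
  by rewrite /spins_of -(inj_eq enum_val_inj) enum_rankK.
rewrite -val_eqE /= (remaining_split (leqnSn k)).
rewrite remaining_None => [|i ki]; last first.
  by apply: contraTneq ki => /position_inj ->; rewrite ltnn.
have tail_eq : [seq remaining k i | i <- rev (iota 0 (p k))] =
    [seq remaining k.+1 i | i <- rev (iota 0 (p k))].
  apply/eq_in_map => j; rewrite mem_rev mem_iota add0n => /= jp.
  rewrite /remaining; congr (if _ is Some i then _ else _); apply: eq_pick => i /=.
  case: (j =P p i) => //= E; rewrite leq_eqVlt; case: (_ =P _) => //= /val_inj ki.
  by move: jp; rewrite E -ki ltnn.
have low : all (fun t : S => if t is Some e then plain e && color_gt (k, false) e else true)
    [seq remaining k.+1 i | i <- rev (iota 0 (p k))].
  apply/allP => _ /mapP[j _ ->]; rewrite /remaining; case: pickP => // i /andP[_ ki].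
  by rewrite /plain /= color_gtE.
have sz : size [seq remaining k.+1 i | i <- rev (iota 0 (p k))] = p k.
  by rewrite size_map size_rev size_iota.
rewrite tail_eq (@turn_lines_first F n w z (k, false)) ?sz //.
by rewrite size_tuple; have := position_lt k; lia.
Qed.

Lemma model_identity (v : 'I_n -> F) a : (forall i, a i = (i, true)) ->
  model_mx m q v a (enum_rank (remaining_tuple 0))
    (enum_rank (remaining_tuple n)) = \prod_i v i ^+ p i.
Proof.
move=> aE; apply: (prod_chain (x := fun k => enum_rank (remaining_tuple k))) => k y.
by rewrite aE pair_mx_identity.
Qed.
End Identity.

Lemma remaining_full n m (lambda : 'I_n -> nat) :
  remaining_tuple m (fun i => lambda i + (n - i.+1))%N 0 = top_tuple m lambda.
Proof.
apply: eq_from_tnth => j; rewrite !tnth_mktuple /remaining /top_boundary.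
by congr (if _ is Some i then _ else _); apply: eq_pick => i /=; rewrite andbT.
Qed.

Lemma remaining_empty n m (p : 'I_n -> nat) :
  remaining_tuple m p n = [tuple of nseq m None].
Proof.
apply: eq_from_tnth => j; rewrite tnth_mktuple tnth_nseq remaining_None // => i.
by rewrite leqNgt ltn_ord.
Qed.

Theorem theorem3p10 (R : idomainType) (X : cartan_type) (n m : nat)
    (lambda : n.-tuple nat) (w : {perm signed n}) (s : seq 'I_n) :
  (1 <= n)%N ->
  sorted geq lambda ->
  (head 0%N lambda + n <= m)%N ->
  w \in weyl n ->
  reduced_word s w ->
  partition_function R X m (tnth lambda) w =
    zmonomial R (@rho n) * demazure_atom R X s (tnth lambda).
Proof.
move=> n0 lam_sorted lam_m _; rewrite partition_functionE.
elim: s w => [|i s IH] w red; last first.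
  have {}IH := IH _ (reduced_tail red).
  rewrite /=; case hi : (i.+1 < n)%N; first exact: (model_step_adjacent hi red).
  exact: (model_step_last hi red).
case: red => <- _ /=.
pose p (i : 'I_n) := (tnth lambda i + (n - i.+1))%N.
have lam_le (i j : 'I_n) : (i <= j)%N -> (tnth lambda j <= tnth lambda i)%N.
  move=> ij; rewrite !(tnth_nth 0%N).
  apply: (sorted_leq_nth (leT := geq)) => //; rewrite ?inE ?size_tuple //.
    by move=> a b c /= ba ac; apply: leq_trans ac ba.
  by move=> a; apply: leqnn.
have position_decr (i j : 'I_n) : (i < j)%N -> (p j < p i)%N.
  by move=> ij; have := lam_le _ _ (ltnW ij); have := ltn_ord j; rewrite /p; lia.
have position_lt i : (p i < m)%N.
  have := lam_le (Ordinal n0) i (leq0n i).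
  rewrite [tnth _ (Ordinal n0)](tnth_nth 0%N) /= nth0.
  by have := ltn_ord i; rewrite /p; lia.
rewrite -(remaining_full m (tnth lambda)) -(remaining_empty m p).
rewrite model_identity // => [|i]; last by rewrite /exit_color invg1 perm1.
rewrite /zmonomial -big_split /=; apply: eq_bigr => i _.
by rewrite /p addnC exprD.
Qed.
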